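(* Let $F$ be a global field of characteristic not $2$ or $3$, and let $k\in F^*$. There is a bijection between the ${\rm SL}_2(F)$-orbits on the set of locally soluble forms in $V(F)$ of discriminant $4k$ and the elements of ${\rm Sel}_{\hat\phi}(E_{-27k})$ for the isogeny $\hat\phi\colon E_{-27k}\to E_k$. Under this bijection, the identity element of ${\rm Sel}_{\hat\phi}(E_{-27k})$ corresponds to the unique ${\rm SL}_2(F)$-orbit of reducible binary cubic forms of discriminant $4k$, namely the orbit of $f(x,y)=kx^3+3xy^2$. Moreover, the stabilizer in ${\rm SL}_2(F)$ of any locally soluble $f\in V(F)$ of discriminant $4k$ is isomorphic to $E_{-27k}[\hat\phi](F)$.
   Context: $E_k\colon y^2=x^3+k$; $\hat\phi\colon E_{-27k}\to E_k$ is the $3$-isogeny $(x,y)\mapsto\left(\frac{x^3-108k}{9x^2},\frac{y(x^3+216k)}{27x^3}\right)$. ${\rm Sel}_{\hat\phi}(E_{-27k})\subset H^1(G_F,E_{-27k}[\hat\phi])$ consists of classes whose restriction at every place $v$ of $F$ lies in the image of the connecting map $E_k(F_v)\to H^1(G_{F_v},E_{-27k}[\hat\phi])$. $V(F)$ is the space of binary cubic forms $f=[a,3b,3c,d]=au^3+3bu^2v+3cuv^2+dv^3$, $a,b,c,d\in F$, with ${\rm SL}_2(F)$ acting by linear change of variables; ${\rm disc}(f)=a^2d^2-6abcd+4ac^3+4b^3d-3b^2c^2$. A form $f\in V(F)$ is locally soluble if for every place $v$ of $F$ the equation $z^3=f(u,v)$ has a nonzero solution $(u,v,z)$ over $F_v$.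 *)

(* Defs.v *)
From HB Require Import structures.
From mathcomp Require Import all_boot all_order all_algebra all_field.
From mathcomp Require Import boolp classical_sets functions reals.
From mathcomp Require Import ring.

Set Implicit Arguments.
Unset Strict Implicit.
Unset Printing Implicit Defensive.

Import Order.TTheory GRing.Theory Num.Theory.

Local Open Scope classical_set_scope.
Local Open Scope ring_scope.

Definition global_field (F : fieldType) : Prop :=
  (exists (L : fieldExtType rat) (f : {rmorphism F -> L}), bijective f) \/
  (exists p : nat, prime p /\
   exists (L : fieldExtType {fraction {poly 'F_p}}) (f : {rmorphism F -> L}),
     bijective f).

Record absolute_value (R : realType) (K : fieldType) (abs : K -> R) : Prop :=
  AbsoluteValue {
    abs_ge0 : forall x, 0 <= abs x;
    abs_eq0 : forall x, abs x = 0 <-> x = 0;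
    absM : forall x y, abs (x * y) = abs x * abs y;
    abs_triangle : forall x y, abs (x + y) <= abs x + abs y }.

(* A place is given by a nontrivial absolute value representing it; equivalent
   absolute values have the same completions, so a condition on completions
   imposed for all of them is the condition at every place. *)
Record place (R : realType) (F : fieldType) := Place {
  place_abs :> F -> R;
  place_absP : absolute_value place_abs;
  place_nontrivial : exists2 x, x != 0 & place_abs x != 1 }.

Section MetricNotions.
Variables (R : realType) (K : fieldType) (abs : K -> R).

Definition abs_cvg (u : nat -> K) (l : K) : Prop :=
  forall e : R, 0 < e -> exists N, forall n, (N <= n)%N -> abs (u n - l) < e.

Definition abs_cauchy (u : nat -> K) : Prop :=
  forall e : R, 0 < e ->
  exists N, forall m n, (N <= m)%N -> (N <= n)%N -> abs (u m - u n) < e.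

Definition abs_complete : Prop :=
  forall u, abs_cauchy u -> exists l, abs_cvg u l.

End MetricNotions.

Record completion (R : realType) (F : fieldType) (v : place R F) :=
  Completion {
    cpl_field :> fieldType;
    cpl_emb : {rmorphism F -> cpl_field};
    cpl_abs : cpl_field -> R;
    cpl_absP : absolute_value cpl_abs;
    cpl_abs_emb : forall x, cpl_abs (cpl_emb x) = v x;
    cpl_dense : forall (y : cpl_field) (e : R), 0 < e ->
      exists x, cpl_abs (y - cpl_emb x) < e;
    cpl_completeP : abs_complete cpl_abs }.

Record sep_closure (K : fieldType) := SepClosure {
  sep_field :> fieldType;
  sep_emb : {rmorphism K -> sep_field};
  sep_separable : forall x : sep_field,
    exists2 p : {poly K}, separable_poly p & root (map_poly sep_emb p) x;
  sep_closed : forall p : {poly sep_field},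
    separable_poly p -> (1 < size p)%N -> exists x, root p x }.

Record gal (K : fieldType) (L : sep_closure K) := Gal {
  gal_fun :> {rmorphism L -> L};
  gal_bij : bijective gal_fun;
  gal_fix : forall x, gal_fun (sep_emb L x) = sep_emb L x }.

Lemma gal_mul_fix (K : fieldType) (L : sep_closure K) (s t : gal L) x :
  (s \o t) (sep_emb L x) = sep_emb L x.
Proof. by rewrite /= !gal_fix. Qed.

Definition gal_mul (K : fieldType) (L : sep_closure K) (s t : gal L) : gal L :=
  @Gal K L (s \o t) (bij_comp (gal_bij s) (gal_bij t)) (gal_mul_fix s t).

(* The usual choice made in order to define restriction maps at a place v:
   a completion F_v, a separable closure of F_v, and an F-embedding into it of
   the given separable closure of F. *)
Record localization (R : realType) (F : fieldType) (L : sep_closure F)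
    (v : place R F) := Localization {
  loc_field :> completion v;
  loc_sep : sep_closure loc_field;
  loc_emb : {rmorphism L -> loc_sep};
  loc_embP : forall x,
    loc_emb (sep_emb L x) = sep_emb loc_sep (cpl_emb loc_field x) }.

Section Restriction.
Variables (R : realType) (F : fieldType) (L : sep_closure F) (v : place R F).
Variable D : localization L v.

Lemma sep_root_emb (M : fieldType) (j : {rmorphism L -> M}) (p : {poly L}) t :
  separable_poly p -> root (map_poly j p) t -> exists y, t = j y.
Proof.
have [n] := ubnP (size p); elim: n p => // n IHn p ltpn sep_p rt.
have [sz1|sz1] := leqP (size p) 1.
  have := separable_poly_neq0 sep_p; move: rt; rewrite (size1_polyC sz1).
  by rewrite map_polyC rootC fmorph_eq0 polyC_eq0 => ->.
have [y /factor_theorem[q Dp]] := sep_closed sep_p sz1.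
have p0 := separable_poly_neq0 sep_p.
have q0 : q != 0 by apply: contra_neq p0 => q0; rewrite Dp q0 mul0r.
move: rt; rewrite Dp rmorphM rootM => /orP[rq|]; last first.
  by rewrite rmorphB /= map_polyX map_polyC root_XsubC => /eqP->; exists y.
apply: (IHn q) rq; first by move: ltpn; rewrite Dp size_Mmonic ?monicXsubC //
  size_XsubC addn2 /=.
by move: sep_p; rewrite Dp separable_mul => /and3P[].
Qed.

Lemma gal_res_ex (t : gal (loc_sep D)) :
  exists s : gal L, forall x, t (loc_emb D x) = loc_emb D (s x).
Proof.
pose j := loc_emb D.
have stab (h : {rmorphism loc_sep D -> loc_sep D}) :
    (forall x, h (sep_emb _ x) = sep_emb _ x) ->
  forall x, exists y, h (j x) = j y.
  move=> hfix x; have [p sep_p rp] := sep_separable x.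
  apply: (@sep_root_emb _ j (map_poly (sep_emb L) p)).
    by rewrite separable_map.
  have <- : map_poly h (map_poly j (map_poly (sep_emb L) p)) =
            map_poly j (map_poly (sep_emb L) p).
    by rewrite -!map_poly_comp; apply: eq_map_poly => a /=;
      rewrite loc_embP hfix.
  by rewrite !fmorph_root.
have [f fP] := choice (stab t (gal_fix t)).
have jI : injective j := fmorph_inj j.
have fB : zmod_morphism f.
  by move=> x y; apply: jI; rewrite -fP !rmorphB /= !fP.
have fM : monoid_morphism f.
  split; first by apply: jI; rewrite -fP !rmorph1.
  by move=> x y; apply: jI; rewrite -fP !rmorphM /= !fP.
pose f1 : {rmorphism L -> L} :=
  HB.pack f (GRing.isZmodMorphism.Build L L f fB)
            (GRing.isMonoidMorphism.Build L L f fM).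
have f_fix x : f1 (sep_emb L x) = sep_emb L x.
  by apply: jI; rewrite /= -fP /j loc_embP gal_fix.
have f_surj y : exists x, f x = y.
  have [g tK gK] := gal_bij t.
  have [p sep_p rp] := sep_separable y.
  have [||x Dx] := @sep_root_emb _ j (map_poly (sep_emb L) p) (g (j y)).
  - by rewrite separable_map.
  - rewrite -(fmorph_root t) gK.
    have -> : map_poly t (map_poly j (map_poly (sep_emb L) p)) =
              map_poly j (map_poly (sep_emb L) p).
      by rewrite -!map_poly_comp; apply: eq_map_poly => a /=;
        rewrite loc_embP gal_fix.
    by rewrite fmorph_root.
  by exists x; apply: jI; rewrite -fP -Dx gK.
have [g gP] := choice f_surj.
have f_bij : bijective f1.
  by exists g => x /=; [apply: (fmorph_inj f1); rewrite /= gP | exact: gP].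
by exists (Gal f_bij f_fix) => x /=; rewrite -fP.
Qed.

(* G_{F_v} -> G_F *)
Definition gal_res (t : gal (loc_sep D)) : gal L := projT1 (cid (gal_res_ex t)).

Lemma gal_resP (t : gal (loc_sep D)) x :
  t (loc_emb D x) = loc_emb D (gal_res t x).
Proof. exact: (projT2 (cid (gal_res_ex t)) x). Qed.

End Restriction.

Inductive ec_point (K : fieldType) := Infinity | Affine of K & K.
Arguments Infinity {K}.
Arguments Affine {K}.

Section Curve.
Variable K : fieldType.
Implicit Types (k : K) (P Q : ec_point K).

(* The curve y^2 = x^3 + k. *)
Definition E k : set (ec_point K) :=
  [set P | if P is Affine x y then y ^+ 2 = x ^+ 3 + k else True].

(* The chord-tangent law; the formulas do not involve k. *)
Definition oppE P : ec_point K :=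
  if P is Affine x y then Affine x (- y) else Infinity.

Definition chord (l x1 y1 x2 : K) : ec_point K :=
  let x3 := l ^+ 2 - x1 - x2 in Affine x3 (l * (x1 - x3) - y1).

Definition addE P Q : ec_point K :=
  match P, Q with
  | Infinity, _ => Q
  | _, Infinity => P
  | Affine x1 y1, Affine x2 y2 =>
      if x1 == x2 then
        if y1 == - y2 then Infinity
        else chord (3 * x1 ^+ 2 / (2 * y1)) x1 y1 x2
      else chord ((y2 - y1) / (x2 - x1)) x1 y1 x2
  end.

(* E_{-27k} -> E_k *)
Definition phihat k P : ec_point K :=
  if P is Affine x y then
    if x == 0 then Infinity
    else Affine ((x ^+ 3 - 108 * k) / (9 * x ^+ 2))
                (y * (x ^+ 3 + 216 * k) / (27 * x ^+ 3))
  else Infinity.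

Lemma phihat_E k P : (3 : K) != 0 -> E (- 27 * k) P -> E k (phihat k P).
Proof.
case: P => //= x y n3 Exy; case: ifPn => //= x0.
have n27 : (27 : K) != 0.
  by rewrite (_ : 27 = 3 ^+ 3) ?expf_neq0 // -natrX.
have n9 : (9 : K) != 0.
  by rewrite (_ : 9 = 3 ^+ 2) ?expf_neq0 // -natrX.
rewrite !expr_div_n exprMn Exy; field.
by rewrite x0 n27 n9.
Qed.

Definition ker_phihat k : set (ec_point K) :=
  [set P | E (- 27 * k) P /\ phihat k P = Infinity].

End Curve.

Definition map_point (K M : fieldType) (f : K -> M) (P : ec_point K) :
    ec_point M :=
  if P is Affine x y then Affine (f x) (f y) else Infinity.

Section Cohomology.
Variables (K : fieldType) (L : sep_closure K) (k : K).

Definition cochain := gal L -> ec_point L.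

Definition kerbar : set (ec_point L) := ker_phihat (sep_emb L k).

(* A basis of neighbourhoods of s in the Krull topology consists of the sets of
   all t agreeing with s on a finite subset of L; the module is discrete. *)
Definition continuous_cochain (c : cochain) : Prop :=
  forall s : gal L, exists S : seq L,
  forall t : gal L, {in S, forall x, t x = s x} -> c t = c s.

Definition cocycle : set cochain :=
  [set c | (forall s, kerbar (c s)) /\ continuous_cochain c /\
    forall s t, c (gal_mul s t) = addE (c s) (map_point s (c t))].

Definition cohomologous (c c' : cochain) : Prop :=
  exists2 m, kerbar m &
  forall s, c' s = addE (c s) (addE (map_point s m) (oppE m)).

(* The elements of H^1 are the sets of cochains [H1_class c] with c a cocycle. *)
Definition H1_class (c : cochain) : set cochain :=
  [set c' | cocycle c' /\ cohomologous c c'].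

Definition H1_one : set cochain := H1_class (fun=> Infinity).

(* The image of the connecting map E_k(K) -> H^1(G_K, E_{-27k}[phihat]), which
   sends phihat Q, with Q in E_{-27k}(L), to the class of s |-> s Q - Q. *)
Definition im_delta : set (set cochain) :=
  [set X | exists P : ec_point K, E k P /\
    exists Q : ec_point L, E (- 27 * sep_emb L k) Q /\
      phihat (sep_emb L k) Q = map_point (sep_emb L) P /\
      X = H1_class (fun s => addE (map_point s Q) (oppE Q))].

End Cohomology.

Arguments H1_one {K} L k.
Arguments im_delta {K} L k.

Section Selmer.
Variables (R : realType) (F : fieldType) (L : sep_closure F).
Variable loc : forall v : place R F, localization L v.

Definition res_cochain (v : place R F) (c : cochain L) :
    cochain (loc_sep (loc v)) :=
  fun t => map_point (loc_emb (loc v)) (c (gal_res t)).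

Definition selmer (k : F) : set (set (cochain L)) :=
  [set X | exists2 c, cocycle k c & X = H1_class k c /\
    forall v : place R F,
      let kv := cpl_emb (loc v) k in
      im_delta (loc_sep (loc v)) kv (H1_class kv (res_cochain c))].

End Selmer.

(* [Cubic a b c d] is the form a u^3 + 3b u^2 v + 3c u v^2 + d v^3. *)
Record cubic (K : Type) := Cubic { ca : K; cb : K; cc : K; cd : K }.

Definition cubic_eval (K : comNzRingType) (f : cubic K) (u v : K) : K :=
  ca f * u ^+ 3 + 3 * cb f * u ^+ 2 * v + 3 * cc f * u * v ^+ 2 + cd f * v ^+ 3.

Definition cubic_map (K M : Type) (h : K -> M) (f : cubic K) : cubic M :=
  Cubic (h (ca f)) (h (cb f)) (h (cc f)) (h (cd f)).

Definition cubic_disc (K : comNzRingType) (f : cubic K) : K :=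
  let: Cubic a b c d := f in
  a ^+ 2 * d ^+ 2 - 6 * a * b * c * d + 4 * a * c ^+ 3 + 4 * b ^+ 3 * d
  - 3 * b ^+ 2 * c ^+ 2.

(* (g . f)(u, v) = f((u, v) g) *)
Definition cubic_act (K : comNzRingType) (g : 'M[K]_2) (f : cubic K) : cubic K :=
  let: Cubic a b c d := f in
  let p := g 0 0 in let q := g 0 1 in let r := g 1 0 in let s := g 1 1 in
  Cubic
    (a * p ^+ 3 + 3 * b * p ^+ 2 * q + 3 * c * p * q ^+ 2 + d * q ^+ 3)
    (a * p ^+ 2 * r + b * (p ^+ 2 * s + 2 * p * q * r)
     + c * (q ^+ 2 * r + 2 * p * q * s) + d * q ^+ 2 * s)
    (a * p * r ^+ 2 + b * (q * r ^+ 2 + 2 * p * r * s)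
     + c * (p * s ^+ 2 + 2 * q * r * s) + d * q * s ^+ 2)
    (a * r ^+ 3 + 3 * b * r ^+ 2 * s + 3 * c * r * s ^+ 2 + d * s ^+ 3).

Lemma cubic_actE (K : comNzRingType) (g : 'M[K]_2) (f : cubic K) (u v : K) :
  cubic_eval (cubic_act g f) u v =
  cubic_eval f (u * g 0 0 + v * g 1 0) (u * g 0 1 + v * g 1 1).
Proof. case: f => a b c d; rewrite /cubic_eval /=; ring. Qed.

(* f as an element of K[u][v] *)
Definition cubic_poly (K : fieldType) (f : cubic K) : {poly {poly K}} :=
  cubic_eval (cubic_map (fun a : K => a%:P%:P) f) 'X%:P 'X.

Definition cubic_reducible (K : fieldType) (f : cubic K) : Prop :=
  exists p q : {poly {poly K}},
    [/\ cubic_poly f = p * q, p \isn't a GRing.unit & q \isn't a GRing.unit].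

Section Orbits.
Variable K : fieldType.

Definition SL2 : set 'M[K]_2 := [set g | \det g = 1].

Definition cubic_orbit (f : cubic K) : set (cubic K) :=
  [set h | exists2 g, SL2 g & h = cubic_act g f].

Definition cubic_stab (f : cubic K) : set 'M[K]_2 :=
  [set g | SL2 g /\ cubic_act g f = f].

End Orbits.

Section LocallySoluble.
Variables (R : realType) (F : fieldType) (L : sep_closure F).
Variable loc : forall v : place R F, localization L v.

Definition locally_soluble (f : cubic F) : Prop :=
  forall v : place R F, exists u w z : loc v,
    (u, w, z) <> (0, 0, 0) /\
    z ^+ 3 = cubic_eval (cubic_map (cpl_emb (loc v)) f) u w.

Definition soluble_forms (k : F) : set (cubic F) :=
  [set f | locally_soluble f /\ cubic_disc f = 4 * k].

Definition soluble_orbits (k : F) : set (set (cubic F)) :=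
  [set cubic_orbit f | f in soluble_forms k].

End LocallySoluble.

(* Main.v *)
(* Over a separable closure L every cubic of discriminant 4k is g.f0 with
   g in SL2(L) and f0 = k u^3 + 3 u v^2, because it has a root and a root can be
   moved to u = 0. The stabilizer of f0 in SL2 is a copy of E_{-27k}[phihat], so
   s |-> g^-1 s(g) is a cocycle with values in the kernel; by Hilbert 90 for SL2
   and descent along G_F, this identifies SL2(F)-orbits with H^1. The curve
   z^3 = f0(u, v) is isomorphic to E_{-27k} by (u, v, z) |-> (3z/u, 9v/u), and the
   stabilizer acts on it by translations; hence z^3 = f(u, v) is the torsor under
   E_{-27k} given by the cocycle of f, and over any field it has a point if and
   only if the class of f lies in the image of the connecting map. *)
Require Import Defs.
From HB Require Import structures.
From mathcomp Require Import all_boot all_order all_algebra all_field.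
From mathcomp Require Import boolp classical_sets functions reals.
From mathcomp Require Import ring.

Set Implicit Arguments.
Unset Strict Implicit.
Unset Printing Implicit Defensive.

Import Order.TTheory GRing.Theory Num.Theory.

Local Open Scope classical_set_scope.
Local Open Scope ring_scope.

(* The Galois theory of mathcomp shadows these names. *)
Local Notation gal := Defs.gal.
Local Notation gal_mul := Defs.gal_mul.

(** * Automorphisms of a separable closure *)

(** On the elliptic side the obstacle is that the chord-tangent law comes as bare formulas, and
    associativity for arbitrary points would be a large computation. The cochains take values in a
    group of order three, so nearly all additions involve a kernel point; in the coordinates of
    [psi] such a translation is linear, and its laws are inherited from matrices. The one genuine
    difference s Q - Q of curve points is handled by [addKE] and [subE_ker], which relate P - Q = m
    to P = Q + m. On the field side [sep_closure] is an axiomatic description: that G_K fixes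
    nothing but K is obtained by extending isomorphisms between subfields of L with Zorn's lemma.
    The group is infinite, so continuity reduces Hilbert 90 to the action on a finite Galois-stable
    list. Its solution first lies in GL2; the determinant is G_K-invariant because the cocycle has
    determinant 1, so rescaling one row leads into SL2. *)

Section SubfieldType.
Variables (K : fieldType) (S : divringClosed K).

(** Makes a subfield given by a predicate into a [fieldType], so that polynomials over it can be
    formed; the domain of a partial isomorphism of L is treated in this way. *)
Record subfield_type := SubfieldElt { subfield_val : K; _ : subfield_val \in S }.

HB.instance Definition _ := [isSub for subfield_val].
HB.instance Definition _ := [Choice of subfield_type by <:].
HB.instance Definition _ := [SubChoice_isSubUnitRing of subfield_type by <:].
HB.instance Definition _ := [SubNzRing_isSubComNzRing of subfield_type by <:].
HB.instance Definition _ := [SubComUnitRing_isSubIntegralDomain of subfield_type by <:].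
HB.instance Definition _ := [SubIntegralDomain_isSubField of subfield_type by <:].

End SubfieldType.

Lemma rmorphism_of (A B : nzRingType) (f : A -> B) :
  zmod_morphism f -> monoid_morphism f -> exists g : {rmorphism A -> B}, g =1 f.
Proof.
move=> fB fM.
pose g : {rmorphism A -> B} :=
  HB.pack f (GRing.isZmodMorphism.Build A B f fB)
            (GRing.isMonoidMorphism.Build A B f fM).
by exists g.
Qed.

Lemma poly_roots_list (K : fieldType) (p : {poly K}) : p != 0 ->
  exists2 rs : seq K, uniq rs & forall x, root p x = (x \in rs).
Proof.
have [n] := ubnP (size p); elim: n p => // n IHn p ltpn p0.
have [[x rx]|nr] := pselect (exists x, root p x); last first.
  by exists [::] => // x; apply/negP => rx; case: nr; exists x.
have /factor_theorem[q Dp] := rx.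
have q0 : q != 0 by apply: contra_neq p0 => q0; rewrite Dp q0 mul0r.
have [|rs _ Drs] := IHn q _ q0.
  by move: ltpn; rewrite Dp size_Mmonic ?monicXsubC // size_XsubC addn2.
exists (undup (x :: rs)); first exact: undup_uniq.
by move=> y; rewrite mem_undup Dp rootM Drs root_XsubC in_cons orbC.
Qed.

Section MinimalPolynomial.
Variables (E L : fieldType) (i : {rmorphism E -> L}) (x : L).

(** The embedding i is explicit because m is later carried into L by a second embedding of E; m %| p
    is what lets m inherit separability from p. *)
Lemma minimal_poly_ex (p : {poly E}) : p != 0 -> root (map_poly i p) x ->
  exists m : {poly E}, [/\ m != 0, root (map_poly i m) x, m %| p &
    forall q, root (map_poly i q) x -> m %| q].
Proof.
move=> p0 rp.
have [m [m0 rm minm]] : exists m : {poly E}, [/\ m != 0, root (map_poly i m) x &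
    forall q, q != 0 -> root (map_poly i q) x -> (size m <= size q)%N].
  pose P n := `[< exists2 q : {poly E}, q != 0 &
                    root (map_poly i q) x /\ size q = n >].
  have exP : exists n, P n by exists (size p); apply/asboolP; exists p.
  have [n /asboolP[m m0 [rm sm]] minn] := ex_minnP exP.
  exists m; split => // q q0 rq; rewrite sm; apply: minn.
  by apply/asboolP; exists q.
have dvm q : root (map_poly i q) x -> m %| q.
  move=> rq; rewrite /dvdp; apply/negPn/negP => r0.
  have := minm _ r0; rewrite leqNgt ltn_modp m0 => H.
  have /H// : root (map_poly i (q %% m)) x.
  have := congr1 (map_poly i) (divp_eq q m).
  rewrite rmorphD rmorphM /= => /(congr1 (fun p => p.[x])).
  rewrite hornerD hornerM (rootP rm) (rootP rq) mulr0 add0r => /esym/eqP.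
  by rewrite rootE.
by exists m; split => //; apply: dvm.
Qed.

(** Write m = e d with d the gcd. As d does not vanish at x, e does, so m divides e and d is
    constant. *)
Lemma minimal_poly_coprime (m q : {poly E}) :
  m != 0 -> root (map_poly i m) x ->
  (forall q, root (map_poly i q) x -> m %| q) ->
  ~~ root (map_poly i q) x -> coprimep m q.
Proof.
move=> m0 rm dvm nrq; rewrite -gcdp_eqp1.
have /dvdpP[e De] := dvdp_gcdl m q; set d := gcdp m q in De *.
have nrd : ~~ root (map_poly i d) x.
  apply: contra nrq => rd; have /dvdpP[g ->] := dvdp_gcdr m q.
  by rewrite rmorphM rootM rd orbT.
have d0 : d != 0 by apply: contra_neq m0 => d0; rewrite De d0 mulr0.
have e0 : e != 0 by apply: contra_neq m0 => e0; rewrite De e0 mul0r.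
have /dvm : root (map_poly i e) x.
  by move: rm; rewrite De rmorphM rootM (negPf nrd) orbF.
rewrite [X in X %| _]De -[X in _ %| X]mulr1 dvdp_mul2l //.
by rewrite dvdp1 size_poly_eq1.
Qed.

End MinimalPolynomial.

Section GaloisGroup.
Variables (K : fieldType) (L : sep_closure K).
Implicit Types s t : gal L.

Lemma gal_one_ex : exists s, forall x, s x = x.
Proof.
have fixP x : (idfun : {rmorphism L -> L}) (sep_emb L x) = sep_emb L x by [].
have bij : bijective (idfun : {rmorphism L -> L}) by exists idfun.
by exists (Defs.Gal bij fixP).
Qed.

Lemma gal_inv_ex s : exists t, cancel s t /\ cancel t s.
Proof.
have [g sK gK] := gal_bij s.
have [h Dh] := rmorphism_of (can2_zmod_morphism sK gK)
  (can2_monoid_morphism sK gK).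
have hfix x : h (sep_emb L x) = sep_emb L x by rewrite Dh -{1}(gal_fix s) sK.
have hbij : bijective h by exists s => y; rewrite Dh ?sK ?gK.
by exists (Defs.Gal hbij hfix); split=> y /=; rewrite Dh ?sK ?gK.
Qed.

(* Graphs of isomorphisms over K between two subfields of L. *)
Definition partial_iso (G : set (L * L)) :=
  [/\ forall a, G (sep_emb L a, sep_emb L a),
      forall u v, G u -> G v -> G (u - v),
      forall u v, G u -> G v -> G (u * v),
      forall u, G u -> G (u.1^-1, u.2^-1) &
      forall y, G (0, y) -> y = 0].

Lemma partial_iso_fun G x y y' : partial_iso G -> G (x, y) -> G (x, y') -> y = y'.
Proof.
case=> _ GB _ _ G0 Gy Gy'; apply/eqP; rewrite -subr_eq0; apply/eqP/G0.
by rewrite -(subrr x); apply: (GB (x, y) (x, y')).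
Qed.

(** The first projection of G is a subfield E on which G is single-valued: i is the inclusion of E,
    and j the map whose graph is G. *)
Lemma partial_iso_field G : partial_iso G ->
  exists (E : fieldType) (i j : {rmorphism E -> L}),
    forall u, G u <-> exists a, u = (i a, j a).
Proof.
move=> isoG; have [GK GB GM GV G0] := isoG.
pose D : {pred L} := fun x => `[< exists y, G (x, y) >].
have DP x : reflect (exists y, G (x, y)) (x \in D) by exact: asboolP.
have G1 : G (1, 1) by have := GK 1; rewrite rmorph1.
have Dclosed : divring_closed D.
  split; first by apply/DP; exists 1.
    move=> x x' /DP[y Gy] /DP[y' Gy']; apply/DP; exists (y - y').
    exact: (GB _ _ Gy Gy').
  move=> x x' /DP[y Gy] /DP[y' Gy']; apply/DP; exists (y / y').
  exact: (GM _ _ Gy (GV _ Gy')).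
pose S : divringClosed L :=
  HB.pack D (GRing.isDivringClosed.Build L D Dclosed).
have val_ex (a : subfield_type S) : exists y, G (val a, y).
  by case: a => x /= /DP.
have [f fP] := choice val_ex.
have fE a y : G (val a, y) -> f a = y by apply: partial_iso_fun.
have fB : zmod_morphism f.
  move=> a b; apply: fE; rewrite rmorphB; exact: (GB _ _ (fP a) (fP b)).
have fM : monoid_morphism f.
  split; first by apply: fE; rewrite rmorph1.
  move=> a b; apply: fE; rewrite rmorphM; exact: (GM _ _ (fP a) (fP b)).
have [j Dj] := rmorphism_of fB fM.
exists (subfield_type S), val, j => -[x y]; split=> [Gxy|[a [-> ->]]]; last first.
  by rewrite Dj; apply: fP.
have xD : x \in S by apply/DP; exists y.
by exists (SubfieldElt xD); rewrite Dj (@fE (SubfieldElt xD) y).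
Qed.

(** The map q(x) |-> q(y) is well defined because m divides every q that vanishes at x, and m
    vanishes at y. *)
Lemma partial_iso_adjoin (E : fieldType) (i j : {rmorphism E -> L})
    (e : {rmorphism K -> E}) x y (m : {poly E}) :
  (forall a, i (e a) = sep_emb L a) -> (forall a, j (e a) = sep_emb L a) ->
  m != 0 -> root (map_poly i m) x ->
  (forall q, root (map_poly i q) x -> m %| q) ->
  root (map_poly j m) y ->
  partial_iso [set ((map_poly i q).[x], (map_poly j q).[y]) | q in setT].
Proof.
move=> ie je m0 rx dvm ry; split.
- by move=> a; exists (e a)%:P => //; rewrite !map_polyC !hornerC /= ie je.
- move=> _ _ [p _ <-] [q _ <-]; exists (p - q) => //.
  by rewrite !rmorphB !hornerD !hornerN.
- move=> _ _ [p _ <-] [q _ <-]; exists (p * q) => //.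
  by rewrite !rmorphM !hornerM.
- move=> _ [q _ <-] /=; have [rq|nrq] := boolP (root (map_poly i q) x).
    have /dvdpP[g Dq] := dvm q rq.
    (* Here q(x) = q(y) = 0, and the inverse of 0 is 0 by convention. *)
    exists 0 => //; rewrite Dq !rmorphM !hornerM (rootP rx) (rootP ry) !mulr0.
    by rewrite invr0 !rmorph0 !horner0.
  (* The Bezout coefficient v is an inverse of q modulo m, valid at x and at y alike. *)
  have /Bezout_eq1_coprimepP[[u v] /= Duv] := minimal_poly_coprime m0 rx dvm nrq.
  exists v => //.
  have inv (h : {rmorphism E -> L}) z : root (map_poly h m) z ->
      (map_poly h v).[z] = (map_poly h q).[z]^-1.
    move=> rz; have := congr1 (fun p => (map_poly h p).[z]) Duv.
    rewrite rmorphD !rmorphM rmorph1 hornerD !hornerM (rootP rz) mulr0 add0r.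
    rewrite hornerC => /[dup] H /eqP; have [->|q0] := eqVneq (map_poly h q).[z] 0.
      by rewrite mulr0 eq_sym oner_eq0.
    by move=> _; apply: (mulIf q0); rewrite H mulVf.
  by rewrite !inv.
move=> z [q _ [/eqP rq <-]]; have /dvdpP[g ->] := dvm q rq.
by rewrite rmorphM hornerM (rootP ry) mulr0.
Qed.

(** Surjectivity holds because h maps the finite root set of a polynomial over K injectively into
    itself, hence onto itself. *)
Lemma partial_iso_total G : partial_iso G -> (forall x, exists y, G (x, y)) ->
  exists s, forall x, G (x, s x).
Proof.
move=> isoG Gtot; have [GK GB GM GV G0] := isoG; have [f fP] := choice Gtot.
have fE x y : G (x, y) -> f x = y by apply: partial_iso_fun.
have fB : zmod_morphism f.
  by move=> a b; apply: fE; exact: (GB _ _ (fP a) (fP b)).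
have fM : monoid_morphism f.
  split; first by apply: fE; have := GK 1; rewrite rmorph1.
  by move=> a b; apply: fE; exact: (GM _ _ (fP a) (fP b)).
have [h Dh] := rmorphism_of fB fM.
have hK x : h (sep_emb L x) = sep_emb L x by rewrite Dh; apply: fE.
have hsurj y : exists x, h x = y.
  have [p sep_p rp] := sep_separable y.
  have [|rs urs Drs] := @poly_roots_list _ (map_poly (sep_emb L) p).
    by rewrite map_poly_eq0 separable_poly_neq0.
  have hp : map_poly h (map_poly (sep_emb L) p) = map_poly (sep_emb L) p.
    by rewrite -map_poly_comp; apply: eq_map_poly => a /=; rewrite hK.
  have sub : {subset map h rs <= rs}.
    by move=> _ /mapP[x rx ->]; rewrite -Drs -hp fmorph_root Drs.
  have umap : uniq (map h rs) by rewrite map_inj_uniq //; apply: fmorph_inj.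
  have [|_ /(_ y)] := uniq_min_size umap sub; first by rewrite size_map.
  by rewrite -Drs rp => /mapP[x _ ->]; exists x.
have [g gP] := choice hsurj.
have hbij : bijective h by exists g => x //; apply: (fmorph_inj h); rewrite gP.
by exists (Defs.Gal hbij hK) => x /=; rewrite Dh.
Qed.

(** If a maximal extension missed x, the minimal polynomial of x over its domain, carried along by
    j, would still be separable and so have a root y in L; adjoining (x, y) contradicts
    maximality. *)
Lemma partial_iso_extend G : partial_iso G ->
  exists s, forall u, G u -> u.2 = s u.1.
Proof.
move=> isoG.
pose P (A : set (L * L)) := A = set0 \/ (partial_iso A /\ G `<=` A).
have chainP (C : set (set (L * L))) :
    C `<=` P -> total_on C subset -> P (\bigcup_(X in C) X).
  move=> CP Ctot.
  have [[A [CA A0]]|nA] := pselect (exists A, C A /\ A <> set0); last first.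
    left; apply/seteqP; split => // u [A CA Au]; apply: nA; exists A; split => //.
    by move=> A0; rewrite A0 in Au.
  have iso B u : C B -> B u -> partial_iso B /\ G `<=` B.
    by move=> CB Bu; case: (CP _ CB) => // B0; rewrite B0 in Bu.
  have [[AK AB AM AV Az] GA] : partial_iso A /\ G `<=` A by case: (CP _ CA).
  have bin (op : L * L -> L * L -> L * L) :
    (forall B, partial_iso B -> forall u v, B u -> B v -> B (op u v)) ->
    forall u v, (\bigcup_(X in C) X) u -> (\bigcup_(X in C) X) v ->
      (\bigcup_(X in C) X) (op u v).
    move=> opP u v [B CB Bu] [B' CB' Bv].
    case: (Ctot _ _ CB CB') => sub.
      by exists B' => //; apply: opP => //; [case: (iso _ _ CB' Bv)|exact: sub].
    by exists B => //; apply: opP => //; [case: (iso _ _ CB Bu)|exact: sub].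
  right; split; last by move=> u /GA Au; exists A.
  split.
  - by move=> a; exists A => //; apply: AK.
  - by apply: bin => B [].
  - by apply: bin => B [].
  - by move=> u [B CB Bu]; exists B => //; have [[_ _ _ H _] _] := iso _ _ CB Bu; exact: H.
  - by move=> y [B CB Bu]; case: (iso _ _ CB Bu) => -[_ _ _ _ H] _; exact: H.
have [A [PA maxA]] := Zorn_bigcup chainP.
have PG : P G by right; split.
have nG0 : G !=set0 by case: isoG => GK *; exists (sep_emb L 0, sep_emb L 0).
have [isoA GA] : partial_iso A /\ G `<=` A.
  case: PA => // A0; case: (maxA _ _ PG).
  rewrite A0; split; first by [].
  by case: nG0 => u Gu /(_ _ Gu).
suff Atot x : exists y, A (x, y).
  have [s sP] := partial_iso_total isoA Atot; exists s => -[x y] /GA Axy.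
  exact: (partial_iso_fun isoA Axy).
apply: contrapT => nx.
have [E [i [j AE]]] := partial_iso_field isoA.
have [e eP] : exists e : {rmorphism K -> E},
    forall a, i (e a) = sep_emb L a /\ j (e a) = sep_emb L a.
  have /choice[f fP] : forall a, exists b, (sep_emb L a, sep_emb L a) = (i b, j b).
    by move=> a; apply/AE; case: isoA.
  have fi a : i (f a) = sep_emb L a by case: (fP a).
  have fj a : j (f a) = sep_emb L a by case: (fP a).
  have fB : zmod_morphism f.
    by move=> a b; apply: (fmorph_inj i); rewrite rmorphB !fi rmorphB.
  have fM : monoid_morphism f.
    by split=> [|a b]; apply: (fmorph_inj i);
       rewrite ?rmorph1 ?rmorphM !fi ?rmorph1 ?rmorphM.
  by have [e De] := rmorphism_of fB fM; exists e => a; rewrite !De.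
have [p sep_p rp] := sep_separable x.
have rp' : root (map_poly i (map_poly e p)) x.
  rewrite -map_poly_comp (@eq_map_poly _ _ _ (sep_emb L)) // => a /=.
  by case: (eP a).
have [|m [m0 rm mp dvm]] := minimal_poly_ex _ rp'.
  by rewrite map_poly_eq0 separable_poly_neq0.
have sep_m : separable_poly m by apply: dvdp_separable mp _; rewrite separable_map.
have [||y ry] := @sep_closed _ L (map_poly j m).
- by rewrite separable_map.
- rewrite size_map_poly ltnNge; apply/negP => sz1; move: rm m0.
  by rewrite (size1_polyC sz1) map_polyC /= rootC fmorph_eq0 polyC_eq0 => ->.
have isoB := partial_iso_adjoin (fun a => (eP a).1) (fun a => (eP a).2) m0 rm dvm ry.
set B := (X in partial_iso X) in isoB.
have AB : A `<=` B.
  by move=> u /AE[a ->]; exists a%:P => //; rewrite !map_polyC !hornerC.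
case: (maxA B); last by right; split => // u /GA/AB.
split=> // BA; apply: nx; exists y; apply: BA; exists 'X => //.
by rewrite !map_polyX !hornerX.
Qed.

(** If the minimal polynomial of x over K is not linear, separability provides a root y different
    from x, and the isomorphism sending x to y extends to an automorphism that moves x. *)
Lemma gal_fixed x : (forall s, s x = x) -> exists a, x = sep_emb L a.
Proof.
move=> fixx; have [p sep_p rp] := sep_separable x.
have [|m [m0 rm mp dvm]] := minimal_poly_ex _ rp.
  exact: separable_poly_neq0.
have sep_m : separable_poly (map_poly (sep_emb L) m).
  by rewrite separable_map; apply: dvdp_separable mp _.
have /factor_theorem[q Dm] := rm.
have q0 : q != 0.
  by apply: contra_neq m0 => q0; apply/eqP; rewrite -(map_poly_eq0 (sep_emb L)) Dm q0 mul0r.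
have [sz1|sz1] := leqP (size q) 1.
  have sz2 : size m = 2.
    rewrite -(size_map_poly (sep_emb L)) Dm size_Mmonic ?monicXsubC // size_XsubC addn2 /=.
    by apply/eqP; rewrite eqSS eqn_leq sz1 size_poly_gt0.
  have m1 : m`_1 != 0 by move: m0; rewrite -lead_coef_eq0 lead_coefE sz2.
  exists (- m`_0 / m`_1); rewrite fmorph_div rmorphN.
  have i1 : sep_emb L m`_1 != 0 by rewrite fmorph_eq0.
  apply: (mulIf i1); rewrite mulfVK //.
  move/rootP: rm; rewrite horner_coef size_map_poly sz2 !big_ord_recl big_ord0 /=.
  rewrite expr0 mulr1 addr0 expr1 !coef_map => /eqP.
  by rewrite addr_eq0 => /eqP/(congr1 -%R); rewrite opprK mulrC /bump /= => <-.
move: sep_m; rewrite Dm separable_mul => /and3P[sep_q _ cop].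
have [y ry] := sep_closed sep_q sz1.
have ryx : y != x.
  apply/eqP => yx; have := coprimep_root cop ry.
  by rewrite hornerXsubC yx subrr eqxx.
have rmy : root (map_poly (sep_emb L) m) y by rewrite Dm rootM ry.
have isoG := @partial_iso_adjoin K (sep_emb L) (sep_emb L) idfun x y m
   (fun=> erefl) (fun=> erefl) m0 rm dvm rmy.
have [s sP] := partial_iso_extend isoG.
have := sP (x, y); rewrite /= fixx => H; move: ryx; rewrite H ?eqxx //.
by exists 'X => //; rewrite !map_polyX !hornerX.
Qed.

End GaloisGroup.

(** * Binary cubic forms *)

Section Mx2.
Variable K : comNzRingType.

Definition mx2 (p q r s : K) : 'M[K]_2 :=
  \matrix_(i, j) if i == 0 then (if j == 0 then p else q)
                 else (if j == 0 then r else s).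

Lemma mx2_inj p q r s p' q' r' s' :
  mx2 p q r s = mx2 p' q' r' s' -> [/\ p = p', q = q', r = r' & s = s'].
Proof.
move/matrixP => H.
by split; [have := H 0 0|have := H 0 1|have := H 1 0|have := H 1 1]; rewrite !mxE.
Qed.

Lemma mx2_eta (g : 'M[K]_2) : g = mx2 (g 0 0) (g 0 1) (g 1 0) (g 1 1).
Proof.
apply/matrixP => i j; rewrite !mxE.
case: (i =P 0) => [->|/eqP]; [|rewrite -[i]/(_) => i0].
  case: (j =P 0) => [->//|/eqP j0].
  by congr (g _ _); apply/val_inj; case: j j0 => -[|[]].
have -> : i = 1 by apply/val_inj; case: i i0 => -[|[]].
case: (j =P 0) => [->//|/eqP j0].
by congr (g _ _); apply/val_inj; case: j j0 => -[|[]].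
Qed.

Lemma mx2_mul p q r s p' q' r' s' :
  mx2 p q r s *m mx2 p' q' r' s' =
  mx2 (p * p' + q * r') (p * q' + q * s') (r * p' + s * r') (r * q' + s * s').
Proof.
rewrite [LHS]mx2_eta; congr mx2; by rewrite !mxE !big_ord_recl big_ord0 !mxE /= addr0.
Qed.

Lemma det_mx2 p q r s : \det (mx2 p q r s) = p * s - q * r.
Proof.
rewrite (expand_det_row _ 0) !big_ord_recl big_ord0 /cofactor !det_mx11 !mxE /=.
rewrite /bump /=; ring.
Qed.

Lemma mx2_1 : mx2 1 0 0 1 = 1%:M.
Proof. by rewrite [RHS]mx2_eta !mxE. Qed.

End Mx2.

Lemma map_mx2 (K M : comNzRingType) (f : K -> M) p q r s :
  map_mx f (mx2 p q r s) = mx2 (f p) (f q) (f r) (f s).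
Proof. by rewrite [LHS]mx2_eta !mxE. Qed.

Section CubicAction.
Variable K : comNzRingType.
Implicit Types (f : cubic K) (g h : 'M[K]_2).

Lemma cubic_actM g h f : cubic_act (g *m h) f = cubic_act g (cubic_act h f).
Proof.
rewrite (mx2_eta g) (mx2_eta h) mx2_mul; case: f => a b c d.
rewrite /cubic_act !mxE /=; congr Cubic; ring.
Qed.

Lemma cubic_act1 f : cubic_act 1%:M f = f.
Proof.
rewrite -mx2_1; case: f => a b c d; rewrite /cubic_act !mxE /=; congr Cubic; ring.
Qed.

Lemma cubic_disc_act g f : cubic_disc (cubic_act g f) = (\det g) ^+ 6 * cubic_disc f.
Proof.
rewrite (mx2_eta g) det_mx2; case: f => a b c d.
rewrite /cubic_act /cubic_disc !mxE /=; ring.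
Qed.

Lemma cubic_disc_SL2 g f : \det g = 1 -> cubic_disc (cubic_act g f) = cubic_disc f.
Proof. by move=> dg; rewrite cubic_disc_act dg expr1n mul1r. Qed.

End CubicAction.

Section CubicMap.
Variables (K M : comNzRingType) (h : {rmorphism K -> M}).
Implicit Types (f : cubic K) (g : 'M[K]_2).

Lemma cubic_map_act g f :
  cubic_map h (cubic_act g f) = cubic_act (map_mx h g) (cubic_map h f).
Proof.
case: f => a b c d; rewrite /cubic_act /cubic_map !mxE /=; congr Cubic; ring.
Qed.

Lemma cubic_map_disc f : cubic_disc (cubic_map h f) = h (cubic_disc f).
Proof. case: f => a b c d; rewrite /cubic_disc /=; ring. Qed.

Lemma cubic_map_eval f u v :
  cubic_eval (cubic_map h f) (h u) (h v) = h (cubic_eval f u v).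
Proof. case: f => a b c d; rewrite /cubic_eval /=; ring. Qed.

End CubicMap.

Lemma cubic_map_inj (K M : fieldType) (h : {rmorphism K -> M}) :
  injective (cubic_map h).
Proof.
move=> [a b c d] [a' b' c' d'] [].
by do 4!move/fmorph_inj->.
Qed.

Definition base_cubic (K : nzRingType) (k : K) : cubic K := Cubic k 0 1 0.

Lemma cubic_map_base_cubic (K M : nzRingType) (h : {rmorphism K -> M}) k :
  cubic_map h (base_cubic k) = base_cubic (h k).
Proof. by rewrite /base_cubic /cubic_map /= rmorph0 rmorph1. Qed.

Lemma base_cubic_disc (K : comNzRingType) (k : K) : cubic_disc (base_cubic k) = 4 * k.
Proof. rewrite /cubic_disc /=; ring. Qed.

Lemma base_cubic_eval (K : comNzRingType) (k u v : K) :
  cubic_eval (base_cubic k) u v = k * u ^+ 3 + 3 * u * v ^+ 2.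
Proof. rewrite /cubic_eval /=; ring. Qed.

Lemma fmorph_natr_neq0 (K M : fieldType) (h : {rmorphism K -> M}) n :
  (n%:R : K) != 0 -> (n%:R : M) != 0.
Proof. by rewrite -(rmorph_nat h) fmorph_eq0. Qed.

Lemma four_neq0 (K : fieldType) : (2 : K) != 0 -> (4 : K) != 0.
Proof. by move=> n2; rewrite (_ : 4 = 2 * 2) ?mulf_neq0 // -natrM. Qed.

Lemma SL2_unit (K : comUnitRingType) (g : 'M[K]_2) : \det g = 1 -> g \in unitmx.
Proof. by move=> dg; rewrite unitmxE dg unitr1. Qed.

Section CubicField.
Variable K : fieldType.
Hypothesis n2 : (2 : K) != 0.
Implicit Types (f : cubic K) (g h : 'M[K]_2) (k : K).

Lemma first_row_SL2 (p q : K) : (p, q) <> (0, 0) ->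
  exists g : 'M[K]_2, [/\ \det g = 1, g 0 0 = p & g 0 1 = q].
Proof.
move=> pq0; have [p0|p0] := eqVneq p 0; last first.
  exists (mx2 p q 0 p^-1); rewrite det_mx2 !mxE /= mulr0 subr0 mulfV //.
have q0 : q != 0 by apply/eqP => q0; apply: pq0; rewrite p0 q0.
exists (mx2 p q (- q^-1) 0); rewrite det_mx2 !mxE /= mulr0 sub0r mulrN opprK mulfV //.
Qed.

(* After moving the root to u = 0, the form is v (3bu^2 + 3cuv + dv^2), which is
   base_cubic in the coordinates v / b and -(bu + cv / 2). *)
Lemma rooted_cubic_orbit k f p q : k != 0 -> cubic_disc f = 4 * k ->
  (p, q) <> (0, 0) -> cubic_eval f p q = 0 ->
  exists2 g, \det g = 1 & f = cubic_act g (base_cubic k).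
Proof.
move=> k0 df pq0 fpq; have [g [dg gp gq]] := first_row_SL2 pq0.
have [b [c [d Df]]] : exists b c d, cubic_act g f = Cubic 0 b c d.
  have : ca (cubic_act g f) = 0.
    by rewrite -fpq; case: (f) => a b c d; rewrite /cubic_eval /= gp gq; ring.
  by case: (cubic_act g f) => a b c d /= ->; exists b, c, d.
have := cubic_disc_SL2 f dg; rewrite Df df /cubic_disc => disc.
have n4 := four_neq0 n2.
have b0 : b != 0.
  apply: contra_neq (mulf_neq0 n4 k0) => b0; rewrite -disc b0; ring.
have Dd : d = (4 * k + 3 * c ^+ 2 * b ^+ 2) / (4 * b ^+ 3).
  rewrite -disc; field; by rewrite n4 b0.
exists (invmx g *m mx2 0 (- b) b^-1 (- c / 2)).
  by rewrite det_mulmx det_inv dg invr1 mul1r det_mx2 mul0r sub0r mulNr opprK mulfV.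
rewrite cubic_actM.
have -> : cubic_act (mx2 0 (- b) b^-1 (- c / 2)) (base_cubic k) = cubic_act g f.
  rewrite Df Dd /cubic_act /base_cubic !mxE /=; congr Cubic; field; by rewrite ?n2 ?n4 ?b0.
by rewrite -cubic_actM mulVmx ?cubic_act1 // unitmxE dg unitr1.
Qed.

Lemma cubic_poly_horner f (r : {poly K}) x :
  (cubic_poly f).[r].[x] = cubic_eval f x r.[x].
Proof. case: f => a b c d; rewrite /cubic_poly /cubic_eval /= !hornerE /=. ring. Qed.

(** If d = 0 then (0, 1) is a zero. Otherwise the form, as a polynomial in v over K[u], has unit
    leading coefficient d, so both factors have unit leading coefficients and positive degree. The
    degrees add up to 3, so one factor is linear in v with a root r in K[u], and (1, r(1)) is a
    zero. *)
Lemma cubic_reducible_root f : cubic_reducible f ->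
  exists2 pq, pq <> (0, 0) & cubic_eval f pq.1 pq.2 = 0.
Proof.
have key (p q : {poly {poly K}}) : cubic_poly f = p * q -> q != 0 ->
    (lead_coef p) \is a GRing.unit -> size p = 2 ->
  exists2 pq, pq <> (0, 0) & cubic_eval f pq.1 pq.2 = 0.
  move=> Df q0 up sp; pose r := - (p`_0 / p`_1).
  have up1 : p`_1 \is a GRing.unit by move: up; rewrite lead_coefE sp.
  have rp : p.[r] = 0.
    rewrite horner_coef sp !big_ord_recl big_ord0 /= expr0 mulr1 addr0 expr1.
    by rewrite /bump /= /r mulrN mulrC divrK // subrr.
  exists (1, r.[1]); first by move/(congr1 fst)/eqP; rewrite /= oner_eq0.
  by rewrite /= -cubic_poly_horner Df hornerM rp mul0r horner0.
case=> p [q [Df np nq]].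
have [d0|d0] := eqVneq (cd f) 0.
  exists (0, 1); first by move/(congr1 snd)/eqP; rewrite /= oner_eq0.
  by rewrite /cubic_eval d0 /=; ring.
have cubicE : cubic_poly f = (((cd f)%:P%:P * 'X + (3 * (cc f)%:P * 'X)%:P) * 'X
    + (3 * (cb f)%:P * 'X ^+ 2)%:P) * 'X + ((ca f)%:P * 'X ^+ 3)%:P.
  rewrite /cubic_poly /cubic_eval /=; ring.
have cP : (cubic_poly f)`_3 = (cd f)%:P.
  by rewrite cubicE !(coefD, coefMX, coefC) /= !addr0.
have sP : size (cubic_poly f) = 4.
  have step (r : {poly {poly K}}) c n : size r = n.+1 -> size (r * 'X + c%:P) = n.+2.
    by move=> sr; rewrite size_MXaddC -size_poly_eq0 sr.
  by rewrite cubicE; do 3!apply: (step); rewrite size_polyC polyC_eq0 d0.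
have P0 : cubic_poly f != 0 by rewrite -size_poly_eq0 sP.
have p0 : p != 0 by apply: contra_neq P0 => p0; rewrite Df p0 mul0r.
have q0 : q != 0 by apply: contra_neq P0 => q0; rewrite Df q0 mulr0.
have : (lead_coef p * lead_coef q) \is a GRing.unit.
  by rewrite -lead_coefM -Df lead_coefE sP cP poly_unitE size_polyC d0 coefC /= unitfE.
rewrite unitrM => /andP[up uq].
have big (r : {poly {poly K}}) :
    lead_coef r \is a GRing.unit -> r \isn't a GRing.unit -> (1 < size r)%N.
  move=> ur; apply: contraR; rewrite -leqNgt => s1; rewrite (size1_polyC s1) in ur *.
  by move: ur; rewrite lead_coefC => ur; apply: rmorph_unit.
have := big p up np; have := big q uq nq.
have := sP; rewrite Df size_mul // => spq sq1 sp1.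
have [sp|sq] : size p = 2 \/ size q = 2.
  move: spq sq1 sp1; case: (size p) => [|[|[|?]]] //; first by left.
  by case: (size q) => [|[|[|?]]] //; [right|rewrite !addnS].
  exact: key Df q0 up sp.
by apply: (key q p _ p0 uq sq); rewrite mulrC.
Qed.

(** The factorisation u (k u^2 + 3 v^2) is carried along by the substitution; both factors vanish at
    the origin, so neither is a unit. *)
Lemma base_cubic_orbit_reducible k g : cubic_reducible (cubic_act g (base_cubic k)).
Proof.
have nonunit (p : {poly {poly K}}) : p.[0].[0] = 0 -> p \isn't a GRing.unit.
  move=> p0; apply/negP => /mulrV/(congr1 (fun q : {poly {poly K}} => q.[0].[0])).
  by rewrite !hornerM p0 mul0r !hornerC => /eqP; rewrite eq_sym oner_eq0.
pose i : K -> {poly {poly K}} := polyC \o polyC.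
pose U : {poly {poly K}} := 'X%:P * i (g 0 0) + 'X * i (g 1 0).
pose V : {poly {poly K}} := 'X%:P * i (g 0 1) + 'X * i (g 1 1).
exists U, (i k * U ^+ 2 + 3 * V ^+ 2); split.
- rewrite /cubic_poly; have := @cubic_map_act K _ (i : {rmorphism _ -> _}) g (base_cubic k).
  rewrite /cubic_map => ->; rewrite cubic_actE !mxE /cubic_eval /=.
  by rewrite -/U -/V !(polyC0, polyC1) /i /=; ring.
- by apply: nonunit; rewrite /U /i !hornerE.
- by apply: nonunit; rewrite /U /V /i !hornerE /=; ring.
Qed.

End CubicField.

Lemma cubic_horner (K : comNzRingType) (a b c d x : K) :
  (a%:P * 'X^3 + (3 * b)%:P * 'X^2 + (3 * c)%:P * 'X + d%:P).[x] =
  cubic_eval (Cubic a b c d) x 1.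
Proof. rewrite !hornerE /cubic_eval /=; ring. Qed.

(* The Bezout relation is a disc(f) = 4 H^2 Q - (2 a H X - a J + 4 b H) T with
   Q = p' / 3, H = a c - b^2, J = a d - b c and T = a (p - X Q) - b Q = 2 H X + J. *)
Lemma cubic_root_ex (K : fieldType) (L : sep_closure K) (f : cubic L) :
  (3 : L) != 0 -> cubic_disc f != 0 ->
  exists2 pq, pq <> (0, 0) & cubic_eval f pq.1 pq.2 = 0.
Proof.
case: f => a b c d n3 df; have [a0|a0] := eqVneq a 0.
  exists (1, 0); first by move/(congr1 fst)/eqP; rewrite /= oner_eq0.
  rewrite a0 /cubic_eval /=; ring.
pose p : {poly L} := a%:P * 'X^3 + (3 * b)%:P * 'X^2 + (3 * c)%:P * 'X + d%:P.
have dp : p^`() = 3 * (a%:P * 'X^2 + 2 * b%:P * 'X + c%:P).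
  rewrite /p !(derivD, derivM, derivC, derivXn, derivX) /=; ring.
have sep_p : separable_poly p.
  rewrite unlock; apply/Bezout_coprimepP.
  pose H := a * c - b ^+ 2; pose J := a * d - b * c.
  pose S : {poly L} := (2 * a * H)%:P * 'X + (4 * b * H - a * J)%:P.
  exists (- 3 * a%:P * S, (4 * H ^+ 2)%:P + S * (a%:P * 'X + b%:P)).
  rewrite [X in X %= _](_ : _ = (3 * a * cubic_disc (Cubic a b c d))%:P).
    by rewrite polyC_eqp1 !mulf_neq0.
  rewrite dp /= /S /p /H /J; ring.
have sz : (1 < size p)%N.
  rewrite ltnNge; apply/negP => /(leq_sizeP p 1)/(_ 3 isT)/eqP.
  rewrite /p !coefE /= !(mulr0, addr0) mulr1 (negPf a0) //.
have [x rx] := sep_closed sep_p sz.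
exists (x, 1); first by move/(congr1 snd)/eqP; rewrite /= oner_eq0.
by rewrite -cubic_horner; apply/rootP.
Qed.

Section RowVectors.
Variable K : comNzRingType.

Definition cubic_ev (f : cubic K) (x : 'rV[K]_2) : K :=
  cubic_eval f (x 0 0) (x 0 1).

Lemma cubic_evZ f c x : cubic_ev f (c *: x) = c ^+ 3 * cubic_ev f x.
Proof. rewrite /cubic_ev /cubic_eval !mxE; ring. Qed.

Lemma row2P (x y : 'rV[K]_2) : x 0 0 = y 0 0 -> x 0 1 = y 0 1 -> x = y.
Proof.
move=> e0 e1; apply/rowP => -[[|[|//]] lt_i].
  by rewrite (_ : Ordinal lt_i = 0) //; apply: val_inj.
by rewrite (_ : Ordinal lt_i = 1) //; apply: val_inj.
Qed.

Lemma row2_mul (x : 'rV[K]_2) p q r s : x *m mx2 p q r s =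
  \row_j (if j == 0 then x 0 0 * p + x 0 1 * r else x 0 0 * q + x 0 1 * s).
Proof.
have e1 : lift ord0 ord0 = 1 :> 'I_2 by apply: val_inj.
by apply: row2P; rewrite !mxE !big_ord_recl big_ord0 !e1 !mxE /= addr0.
Qed.

Lemma cubic_ev_act g f x : cubic_ev (cubic_act g f) x = cubic_ev f (x *m g).
Proof. by rewrite /cubic_ev cubic_actE (mx2_eta g) row2_mul !mxE. Qed.

End RowVectors.

Lemma cubic_orbit_refl (K : fieldType) (f : cubic K) : cubic_orbit f f.
Proof. by exists 1%:M; rewrite ?cubic_act1 // /SL2 /= det1. Qed.

Lemma cubic_orbit_sym (K : fieldType) (f f' : cubic K) :
  cubic_orbit f f' -> cubic_orbit f' f.
Proof.
case=> h dh ->; exists (invmx h); first by rewrite /SL2 /= det_inv dh invr1.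
by rewrite -cubic_actM mulVmx ?cubic_act1 // SL2_unit.
Qed.

Lemma cubic_orbit_trans (K : fieldType) (f f' f'' : cubic K) :
  cubic_orbit f f' -> cubic_orbit f' f'' -> cubic_orbit f f''.
Proof.
case=> h dh -> [h' dh' ->]; exists (h' *m h); last by rewrite cubic_actM.
by rewrite /SL2 /= det_mulmx dh dh' mulr1.
Qed.

Lemma cubic_orbit_eq (K : fieldType) (f f' : cubic K) :
  cubic_orbit f f' -> cubic_orbit f = cubic_orbit f'.
Proof.
move=> ff'; apply/seteqP; split=> f''; last exact: cubic_orbit_trans.
exact/cubic_orbit_trans/cubic_orbit_sym.
Qed.

(** * The kernel of the isogeny *)

Section Kernel.
Variables (K : fieldType) (k : K).
Hypotheses (n2 : (2 : K) != 0) (n3 : (3 : K) != 0) (k0 : k != 0).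
Implicit Types (m n : ec_point K) (P Q : ec_point K) (t : K).

Lemma ker_phihatP m : ker_phihat k m <->
  m = Infinity \/ exists2 t, t ^+ 2 = - 27 * k & m = Affine 0 t.
Proof.
split=> [[]|[->|[t Et ->]]]; [|by split|by rewrite /ker_phihat /= eqxx Et expr0n add0r].
case: m => [|x t]; first by left.
rewrite /=; case: eqP => //= -> Et _; right; exists t => //.
by rewrite Et expr0n add0r.
Qed.

Let n27 : (27 : K) != 0.
Proof. by rewrite (_ : 27 = 3 ^+ 3) ?expf_neq0 // -natrX. Qed.

Let n6 : (6 : K) != 0.
Proof. by rewrite (_ : 6 = 2 * 3) ?mulf_neq0 // -natrM. Qed.

Let n9 : (9 : K) != 0.
Proof. by rewrite (_ : 9 = 3 ^+ 2) ?expf_neq0 // -natrX. Qed.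

Lemma kerpoint_neq0 t : t ^+ 2 = - 27 * k -> t != 0.
Proof.
move=> Et; apply: contra_neq k0 => t0; apply/eqP; move/eqP: Et.
by rewrite t0 expr0n /= mulNr eq_sym oppr_eq0 mulf_eq0 (negPf n27).
Qed.

Lemma ker_sqE t : t ^+ 2 = - 27 * k -> k = - (t ^+ 2) / 27.
Proof. by move=> ->; field; exact: n27. Qed.

Lemma neq_opp t : t != 0 -> (t == - t) = false.
Proof.
move=> t0; apply/negP; rewrite -subr_eq0 opprK (_ : t + t = 2 * t); last by ring.
by rewrite mulf_eq0 (negPf n2) (negPf t0).
Qed.

Lemma dbl_neq0 t : t != 0 -> t + t != 0.
Proof. by move=> t0; rewrite -[X in _ + X]opprK subr_eq0 neq_opp. Qed.

(* With w^2 = -3 and r^2 = k, (ru + v, ru - v) are eigencoordinates for the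
   matrix attached to t = 3wr, with eigenvalues (-1 + w) / 2 and (-1 - w) / 2. *)
Definition stab_mx m : 'M[K]_2 :=
  if m is Affine _ t then mx2 (- 2^-1) (t / 6) (t / (6 * k)) (- 2^-1) else 1%:M.

Lemma stab_mx_det m : ker_phihat k m -> \det (stab_mx m) = 1.
Proof.
case/ker_phihatP => [->|[t Et ->]]; first by rewrite det1.
rewrite /stab_mx det_mx2 (ker_sqE Et); field.
by rewrite n27 oppr_eq0 expf_neq0 ?(kerpoint_neq0 Et) ?n6 ?n2.
Qed.

Lemma stab_mx_act m : ker_phihat k m -> cubic_act (stab_mx m) (base_cubic k) = base_cubic k.
Proof.
case/ker_phihatP => [->|[t Et ->]]; first exact: cubic_act1.
rewrite /stab_mx /cubic_act /base_cubic !mxE /= (ker_sqE Et); congr Cubic; field;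
  by rewrite ?oppr_eq0 ?expf_neq0 ?n27 ?n6 ?n2 ?(kerpoint_neq0 Et).
Qed.

Lemma stab_mx_inj m n : ker_phihat k m -> ker_phihat k n ->
  stab_mx m = stab_mx n -> m = n.
Proof.
have half : - 2^-1 != 1 :> K.
  apply: contra_neq n3 => /(congr1 (fun x => 1 - x)).
  rewrite opprK subrr => /(congr1 ( *%R^~ 2)).
  by rewrite mul0r mulrDl mulVf // mul1r => <-; ring.
case/ker_phihatP => [->|[t Et ->]] /ker_phihatP [->|[t' Et' ->]] //=.
- by rewrite -mx2_1 => /mx2_inj[/esym/eqP]; rewrite (negPf half).
- by rewrite -mx2_1 => /mx2_inj[/eqP]; rewrite (negPf half).
by case/mx2_inj => _ /(divIf n6) -> _ _.
Qed.

(** The last coefficient of the transformed form is r (k r^2 + 3 s^2). The case r = 0 leaves the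
    identity; the other case fixes s and p as -1/2 and ties q to r. *)
Lemma stab_base_cubicP g : \det g = 1 -> cubic_act g (base_cubic k) = base_cubic k ->
  exists2 m, ker_phihat k m & g = stab_mx m.
Proof.
rewrite (mx2_eta g) det_mx2.
move: (g 0 0) (g 0 1) (g 1 0) (g 1 1) => p q r s dg.
rewrite /cubic_act /base_cubic !mxE /= => -[].
rewrite !(mulr0, mul0r, addr0, add0r, mulr1, mul1r) => _ Eb Ec Ed.
have [r0|r0] := eqVneq r 0.
  move: dg Eb Ec; rewrite r0 !(expr0n, mulr0, addr0, subr0, add0r) /= => ps Eb Ec.
  have s1 : s = 1 by rewrite -[RHS]Ec mul0r addr0 expr2 mulrA ps mul1r.
  have p1 : p = 1 by rewrite -ps s1 mulr1.
  have q0 : q = 0.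
    by move/eqP: Eb; rewrite p1 s1 !mulr1 mulf_eq0 (negPf n2) => /eqP.
  by exists Infinity; [apply/ker_phihatP; left | rewrite p1 q0 s1 mx2_1].
have Er : k * r ^+ 2 = - (3 * s ^+ 2).
  apply: (mulIf r0); apply/eqP; rewrite -subr_eq0 -Ed; apply/eqP; ring.
(* With k r^2 = -3 s^2 the third coefficient becomes -2 s (p s - q r) = -2 s, and it has to be 1. *)
have Es : 2 * s = - 1.
  rewrite -[X in - X]Ec -[LHS]mulr1 -[X in _ * X = _]dg; ring: Er.
have {}Es : s = - 2^-1 by apply: (mulfI n2); rewrite mulrN mulfV.
have {}Er : k * r ^+ 2 = - 3 / 4.
  by rewrite Er Es; field; rewrite ?four_neq0 ?n2.
have Ep : p = - 2 * (1 + q * r).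
  by rewrite -[X in X + _]dg Es; field.
have Eqr : q * r = - 3 / 4.
  have n4 := four_neq0 n2; apply: (mulfI n4).
  have Ek : k = - 3 / (4 * r ^+ 2) by rewrite invfM mulrA -Er mulfK ?expf_neq0.
  apply/eqP; rewrite -subr_eq0 -(mulr0 (- r)) -Eb Es Ep Ek; apply/eqP.
  by field; rewrite n2 n4 r0.
have {}Ep : p = - 2^-1.
  by rewrite Ep Eqr; field; rewrite ?four_neq0 ?n2.
have Eq : q = k * r by apply: (mulIf r0); rewrite Eqr -Er; ring.
(* The value of t is read off the lower left entry r = t / (6 k). *)
exists (Affine 0 (6 * k * r)).
  apply/ker_phihatP; right; exists (6 * k * r) => //.
  rewrite (_ : _ ^+ 2 = 36 * k * (k * r ^+ 2)); last by ring.
  by rewrite Er; field; rewrite ?four_neq0 ?n2.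
rewrite /stab_mx Ep Es Eq; congr mx2; field; rewrite ?n6 ?k0 //.
Qed.

(* The isomorphism from z^3 = base_cubic(x) onto E_{-27k}; only u = 0 gives Infinity. *)
Definition psi (x : 'rV[K]_2) (z : K) : ec_point K :=
  if x 0 0 == 0 then Infinity else Affine (3 * z / x 0 0) (9 * x 0 1 / x 0 0).

(** With [lift_z], a section of [psi]: affine points are lifted with u = 1, and [Infinity] to (0, 1,
    0), the only projective point of the curve with u = 0. *)
Definition lift_row Q : 'rV[K]_2 :=
  if Q is Affine x y then \row_j (if j == 0 then 1 else y / 9)
  else \row_j (if j == 0 then 0 else 1).

Definition lift_z Q : K := if Q is Affine x y then x / 3 else 0.

Lemma psi_lift Q : psi (lift_row Q) (lift_z Q) = Q.
Proof.
case: Q => [|x y]; rewrite /psi !mxE /= ?eqxx // oner_eq0.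
by rewrite !divr1 ![_ * (_ / _)]mulrC !divfK ?n9.
Qed.

Lemma lift_curve Q : E (- 27 * k) Q ->
  lift_z Q ^+ 3 = cubic_ev (base_cubic k) (lift_row Q).
Proof.
rewrite /cubic_ev base_cubic_eval; case: Q => [_|x y] /=; rewrite !mxE /=; first by ring.
have n81 : (81 : K) != 0 by rewrite (_ : 81 = 3 ^+ 4) ?expf_neq0 // -natrX.
by move=> Ey; rewrite !expr_div_n Ey; field; rewrite n81 n27.
Qed.

Lemma lift_row_neq0 Q : lift_row Q != 0.
Proof.
case: Q => [|x y]; apply/eqP => /rowP; first by move/(_ 1)/eqP; rewrite !mxE /= oner_eq0.
by move/(_ 0)/eqP; rewrite !mxE /= oner_eq0.
Qed.

Lemma psi_E x z : z ^+ 3 = cubic_ev (base_cubic k) x -> E (- 27 * k) (psi x z).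
Proof.
rewrite /cubic_ev base_cubic_eval /psi; case: eqP => //= /eqP x0 Ez.
rewrite !expr_div_n !exprMn Ez; field; exact: x0.
Qed.

(** [psi] forgets exactly the common scaling of (u, v, z). When u = 0 the equation forces z = 0, and
    the scalar is the ratio of the v-coordinates. *)
Lemma psi_inj x z x' z' :
  z ^+ 3 = cubic_ev (base_cubic k) x -> z' ^+ 3 = cubic_ev (base_cubic k) x' ->
  x != 0 -> x' != 0 -> psi x z = psi x' z' ->
  exists c, x = c *: x' /\ z = c * z'.
Proof.
rewrite /cubic_ev !base_cubic_eval /psi => Ez Ez' nx nx'.
have [x0|x0] := eqVneq (x 0 0) 0; have [x0'|x0'] := eqVneq (x' 0 0) 0 => //.
  have zz a (y b : K) : a = 0 -> b ^+ 3 = k * a ^+ 3 + 3 * a * y ^+ 2 -> b = 0.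
    move=> -> /eqP; rewrite expr0n /= !(mulr0, mul0r, addr0).
    by rewrite expf_eq0 /= => /eqP.
  rewrite (zz _ _ _ x0 Ez) (zz _ _ _ x0' Ez') => _.
  have x1' : x' 0 1 != 0.
    by apply: contra_neq nx' => e; apply: row2P; rewrite mxE.
  exists (x 0 1 / x' 0 1); split; last by rewrite mulr0.
  by apply: row2P; rewrite !mxE ?x0 ?x0' ?mulr0 ?divfK.
case=> E1 E2; exists (x 0 0 / x' 0 0); split.
  apply: row2P; rewrite !mxE ?divfK //.
  apply: (mulfI n9); apply: (mulIf (invr_neq0 x0)); rewrite E2.
  by field; rewrite x0 x0'.
apply: (mulfI n3); apply: (mulIf (invr_neq0 x0)); rewrite E1.
by field; rewrite x0 x0'.
Qed.

(** * Translation by kernel points *)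

Lemma addE0 P : addE P Infinity = P. Proof. by case: P. Qed.

Lemma curveP t x y : t ^+ 2 = - 27 * k -> E (- 27 * k) (Affine x y) ->
  x ^+ 3 = y ^+ 2 - t ^+ 2.
Proof. by move=> Et /= ->; rewrite Et addrK. Qed.

(** On the curve x^3 = (y - t)(y + t), so t + y vanishes only together with x; the same
    factorisation turns the chord formula into fractions with denominator t + y. *)
Lemma addE_ker t x y : t ^+ 2 = - 27 * k -> E (- 27 * k) (Affine x y) -> x != 0 ->
  t + y != 0 /\ addE (Affine x y) (Affine 0 t) =
    Affine (- 2 * t * x / (t + y)) (- t * (3 * t - y) / (t + y)).
Proof.
move=> Et Exy x0; have Ex := curveP Et Exy.
have ty0 : t + y != 0.
  apply: contra_neq x0 => ty; apply/eqP.
  have : x ^+ 3 == 0.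
    by rewrite Ex subr_sqr [y + t]addrC ty mulr0.
  by rewrite expf_eq0.
split=> //; rewrite /addE (negPf x0) /chord sub0r.
have E1 : ((t - y) / - x) ^+ 2 - x - 0 = - 2 * t * x / (t + y).
  by field: Ex; rewrite ty0 oppr_eq0 x0.
rewrite E1; congr Affine; field: Ex; by rewrite ty0 oppr_eq0 x0.
Qed.

(** The points with x = 0 are flexes with horizontal tangent, so doubling one of them is
    negation. *)
Lemma addE_kerD t t' : t ^+ 2 = - 27 * k -> t' ^+ 2 = - 27 * k ->
  addE (Affine 0 t) (Affine 0 t') =
  if t == - t' then Infinity else Affine 0 (- t).
Proof.
move=> Et Et'; rewrite /addE eqxx; case: eqP => // _.
by rewrite /chord expr0n /= mulr0 mul0r expr0n /= !subr0 mul0r sub0r.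
Qed.

Lemma ker_sq t t' : t ^+ 2 = - 27 * k -> t' ^+ 2 = - 27 * k -> t = t' \/ t = - t'.
Proof. by move=> <- /eqP; rewrite eq_sym eqf_sqr => /orP[] /eqP; [left|right]. Qed.

Lemma ker_x0 y : E (- 27 * k) (Affine 0 y) -> y ^+ 2 = - 27 * k.
Proof. by move=> /= ->; rewrite expr0n /= add0r. Qed.

Lemma ker_addE m n : ker_phihat k m -> ker_phihat k n -> ker_phihat k (addE m n).
Proof.
case/ker_phihatP => [->|[t Et ->]] //; case/ker_phihatP => [->|[t' Et' ->]].
  by apply/ker_phihatP; right; exists t.
rewrite addE_kerD //; case: ifP => _; apply/ker_phihatP; [by left|right].
by exists (- t); rewrite // sqrrN.
Qed.

Lemma ker_oppE m : ker_phihat k m -> ker_phihat k (oppE m).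
Proof.
case/ker_phihatP => [->|[t Et ->]]; apply/ker_phihatP; [by left|right].
by exists (- t); rewrite ?sqrrN.
Qed.

Lemma ker_addC m n : ker_phihat k m -> ker_phihat k n -> addE m n = addE n m.
Proof.
case/ker_phihatP => [->|[t Et ->]]; case/ker_phihatP => [->|[t' Et' ->]] //.
rewrite !addE_kerD // -eqr_oppLR eq_sym; case: eqVneq => // ne.
by case: (ker_sq Et Et') => [->//|e]; rewrite e opprK eqxx in ne.
Qed.

Lemma stab_mxD m n : ker_phihat k m -> ker_phihat k n ->
  stab_mx (addE m n) = stab_mx m *m stab_mx n.
Proof.
case/ker_phihatP => [->|[t Et ->]]; case/ker_phihatP => [->|[t' Et' ->]]; rewrite ?mul1mx ?mulmx1 //.
have t0 := kerpoint_neq0 Et;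
rewrite addE_kerD //; have [-> |->] := ker_sq Et' Et.
  rewrite neq_opp // /stab_mx mx2_mul (ker_sqE Et); congr mx2; field;
  by rewrite ?oppr_eq0 ?expf_neq0 ?n27 ?n6 ?n2 ?t0.
rewrite opprK eqxx /stab_mx mx2_mul (ker_sqE Et) -mx2_1; congr mx2; field;
by rewrite ?oppr_eq0 ?expf_neq0 ?n27 ?n6 ?n2 ?t0.
Qed.

(** In affine coordinates (X, Y) the matrix multiplies u by -(t + Y) / (2 t); dividing by the new u
    gives exactly the formulas of [addE_ker]. The cases u = 0 and X = 0, where [addE] takes other
    branches, are checked apart. *)
Lemma psi_add x z m : x != 0 -> z ^+ 3 = cubic_ev (base_cubic k) x -> ker_phihat k m ->
  psi (x *m stab_mx m) z = addE (psi x z) m.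
Proof.
move=> nx Ez; case/ker_phihatP => [->|[t Et ->]]; first by rewrite mulmx1 addE0.
have t0 := kerpoint_neq0 Et;
have Ek := ker_sqE Et; have EP := psi_E Ez.
have n18 : (18 : K) != 0 by rewrite (_ : 18 = 6 * 3) ?mulf_neq0 // -natrM.
rewrite /stab_mx row2_mul /psi !mxE /=; rewrite /psi in EP.
have [u0|u0] := eqVneq (x 0 0) 0.
  have w0 : x 0 1 != 0.
    by apply: contra_neq nx => w0; apply: row2P; rewrite mxE.
  have z0 : z = 0.
    move: Ez; rewrite /cubic_ev base_cubic_eval u0 expr0n /= !(mulr0, mul0r, addr0).
    by move/eqP; rewrite expf_eq0 => /eqP.
  rewrite u0 z0 !(mul0r, add0r, mulr0) ifF; last first.
    by rewrite !mulf_eq0 !invr_eq0 mulf_eq0 (negPf w0) (negPf t0) (negPf n6) (negPf k0).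
  congr Affine; rewrite Ek; field.
  by rewrite ?oppr_eq0 ?expf_neq0 ?n27 ?n6 ?n2 ?t0 ?w0.
rewrite (negPf u0) in EP.
set X := 3 * z / x 0 0 in EP *; set Y := 9 * x 0 1 / x 0 0 in EP *.
have Eu : x 0 0 * - 2^-1 + x 0 1 * (t / (6 * k)) = - x 0 0 * (t + Y) / (2 * t).
  rewrite Ek /Y; field.
  by rewrite ?oppr_eq0 ?expf_neq0 ?n27 ?n6 ?n2 ?t0 ?u0.
have Ew : x 0 0 * (t / 6) + x 0 1 * - 2^-1 = x 0 0 * (3 * t - Y) / 18.
  by rewrite /Y; field; rewrite ?u0 ?n18 ?n6 ?n2.
rewrite Eu Ew.
have [X0|X0] := eqVneq X 0; last first.
  have [ty0 ->] := addE_ker Et EP X0.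
  rewrite ifF; last by rewrite !mulf_eq0 invr_eq0 mulf_eq0 oppr_eq0 (negPf u0) (negPf ty0)
    (negPf n2) (negPf t0).
  by congr Affine; rewrite ?/X; field; rewrite ?oppr_eq0 ?ty0 ?u0 ?t0 ?n2 ?n18.
have EY : Y ^+ 2 = - 27 * k by move: EP; rewrite X0 => /ker_x0.
have z0 : z = 0.
  by move/eqP: X0; rewrite /X !mulf_eq0 invr_eq0 (negPf n3) (negPf u0) orbF => /eqP.
rewrite X0 addE_kerD // z0.
have [->|->] := ker_sq EY Et.
  rewrite neq_opp // ifF; last first.
    rewrite !mulf_eq0 invr_eq0 mulf_eq0 oppr_eq0 (negPf u0) (negPf n2) (negPf t0) orbF /=.
    by rewrite addr_eq0 neq_opp.
  by congr Affine; field; rewrite ?oppr_eq0 ?t0 ?n2 ?dbl_neq0 ?u0 ?n18.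
by rewrite eqxx subrr mulr0 mul0r eqxx.
Qed.

(** Turns s Q = Q + c(s) into the description c(s) = s Q - Q of the connecting map. *)
Lemma addKE Q m : E (- 27 * k) Q -> ker_phihat k m -> addE (addE Q m) (oppE Q) = m.
Proof.
move=> EQ; case/ker_phihatP => [->|[t Et ->]].
  by rewrite addE0; case: (Q) => //= x y; rewrite eqxx opprK eqxx.
have t0 := kerpoint_neq0 Et.
case: Q EQ => [|x y] EQ; first by [].
have [x0|x0] := eqVneq x 0.
  have Ey : y ^+ 2 = - 27 * k by move: EQ; rewrite x0 => /ker_x0.
  rewrite x0 addE_kerD //; case: (ker_sq Ey Et) => ->.
    by rewrite neq_opp // addE_kerD ?sqrrN // neq_opp ?oppr_eq0 // opprK.
  by rewrite eqxx /= opprK.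
have Ex := curveP Et EQ; have [ty0 ->] := addE_ker Et EQ x0.
(* If y = -3 t then Q + m = - Q, and subtracting Q is a doubling, computed with the tangent. *)
have [ye|ye] := eqVneq (3 * t + y) 0.
  have Ey : y = - (3 * t) by apply/eqP; rewrite -addr_eq0 addrC ye.
  have -> : - 2 * t * x / (t + y) = x.
    by rewrite Ey; field; rewrite -Ey.
  have -> : - t * (3 * t - y) / (t + y) = 3 * t.
    by rewrite Ey; field; rewrite -Ey.
  have n3t : 3 * t != 0 by rewrite mulf_neq0.
  have Ex8 : x ^+ 3 = 8 * t ^+ 2 by rewrite Ex Ey; ring.
  rewrite Ey /= eqxx !opprK neq_opp // /chord.
  have -> : (3 * x ^+ 2 / (2 * (3 * t))) ^+ 2 - x - x = 0.
    by field: Ex8; rewrite t0 n3 n2.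
  by congr Affine; field: Ex8; rewrite t0 n3 n2.
have xne : - 2 * t * x / (t + y) - x != 0.
  rewrite (_ : _ - x = - (x * (3 * t + y) / (t + y))); last by field.
  by rewrite oppr_eq0 !mulf_neq0 ?invr_eq0.
have -> : addE (Affine (- 2 * t * x / (t + y)) (- t * (3 * t - y) / (t + y)))
    (oppE (Affine x y)) =
  chord ((t - y) / x) (- 2 * t * x / (t + y)) (- t * (3 * t - y) / (t + y)) x.
  rewrite /= -subr_eq0 (negPf xne); congr chord.
  field; rewrite x0 ty0 (_ : _ - _ = x * (3 * t + y)) ?mulf_neq0 //; ring.
rewrite /chord.
have -> : ((t - y) / x) ^+ 2 - - 2 * t * x / (t + y) - x = 0.
  by field: Ex; rewrite ?ty0 ?x0.
by congr Affine; field; rewrite ?ty0 ?x0.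
Qed.

(** A converse of [addKE]. When m is not [Infinity], the line through P and - Q meets the curve
    again at - m, where x = 0, which makes its equation explicit. *)
Lemma subE_ker P Q m : E (- 27 * k) P -> E (- 27 * k) Q -> ker_phihat k m ->
  addE P (oppE Q) = m -> P = addE Q m.
Proof.
case: Q => [|x2 y2] EP EQ km; first by rewrite addE0 => ->.
case: P EP => [|x1 y1] EP.
  move=> /= Em; move: km; rewrite -Em => /ker_phihatP[//|[t Et [-> Ey]]].
  by rewrite eqxx opprK eqxx.
rewrite [X in X = m]/=; have [x12|x12] := eqVneq x1 x2.
  case: eqVneq => [-> <-|y12]; first by rewrite opprK x12.
  have Ey : y2 = - y1.
    have : y1 ^+ 2 == y2 ^+ 2 by rewrite EP EQ x12.
    rewrite opprK in y12.
    by rewrite eqf_sqr (negPf y12) => /eqP ->; rewrite opprK.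
  rewrite /chord; case/ker_phihatP: km => [->//|[t Et ->]] [-> E2].
  have t0 := kerpoint_neq0 Et.
  have Ex := curveP Et EP.
  have y0 : y1 != 0 by apply: contra_neq y12 => y10; rewrite Ey y10 !oppr0.
  (* Here P = - Q, so the tangent at P produces m; comparing y-coordinates, with x1^3 = y1^2 - t^2,
     gives this product. *)
  have : (y1 + t) * (3 * t - y1) == 0.
    have -> : (y1 + t) * (3 * t - y1) = 2 * y1 * (y1 + t) - 3 * (y1 ^+ 2 - t ^+ 2) by ring.
    rewrite -Ex -E2 subr0; apply/eqP; field; by rewrite ?y0 ?n2.
  rewrite mulf_eq0 => /orP[]; last first.
    rewrite subr_eq0 => /eqP y3; rewrite -x12 Ey.
    have EQ1 : E (- 27 * k) (Affine x1 (- y1)) by rewrite -Ey x12.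
    have x0 : x1 != 0.
      apply/eqP => x0; move/eqP: Ex; rewrite x0 -y3 expr0n /= eq_sym.
      rewrite (_ : _ - _ = 2 * 2 * 2 * t ^+ 2); last by ring.
      by rewrite !mulf_eq0 (negPf n2) ?expf_eq0 (negPf t0).
    have [ty0 ->] := addE_ker Et EQ1 x0; rewrite -y3 in ty0 *.
    by congr Affine; field.
  rewrite addr_eq0 => /eqP Ey1; have x0 : x1 = 0.
    by move/eqP: Ex; rewrite Ey1 sqrrN subrr expf_eq0 => /eqP.
  by rewrite -x12 Ey Ey1 x0 opprK addE_kerD // neq_opp.
rewrite /chord; set l := (_ / _); case/ker_phihatP: km => [->//|[t Et ->]] [E1].
rewrite E1 subr0 => E2.
have Ex := curveP Et EP.
(* The chord passes through (0, -t), so it is y = l x - t; this is its equation at - Q = (x2,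
   -y2). *)
have lx2 : l * x2 = t - y2.
  have : l * (x2 - x1) = - y2 - y1 by rewrite divfK // subr_eq0 eq_sym.
  by rewrite mulrBr => /eqP; rewrite subr_eq => /eqP ->; rewrite -E2; ring.
clearbody l.
have Ex1 : x1 = l ^+ 2 - x2 by move/eqP: E1; rewrite subr_eq0 => /eqP <-; ring.
have [x20|x20] := eqVneq x2 0.
  have y2t : y2 = t by apply/eqP; rewrite eq_sym -subr_eq0 -lx2 x20 mulr0.
  have l0 : l = 0.
    have Ey : y1 = l * x1 - t by rewrite -E2; ring.
    have : 2 * t * l ^+ 3 == 0.
      have -> : 2 * t * l ^+ 3 = x1 ^+ 3 - (y1 ^+ 2 - t ^+ 2).
        by rewrite Ey Ex1 x20; ring.
      by rewrite Ex subrr.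
    by rewrite 2!mulf_eq0 expf_eq0 (negPf n2) (negPf (kerpoint_neq0 Et)) => /eqP.
  by move: x12; rewrite Ex1 x20 l0 expr0n subr0 eqxx.
rewrite /addE (negPf x20) /chord.
have -> : (t - y2) / (0 - x2) = - l by rewrite -lx2 sub0r invrN mulrN mulfK.
have -> : (- l) ^+ 2 - x2 - 0 = x1 by rewrite subr0 sqrrN.
by congr Affine; rewrite mulNr mulrBr lx2 -E2; ring.
Qed.

Lemma phihat_add Q m : E (- 27 * k) Q -> ker_phihat k m ->
  phihat k (addE Q m) = phihat k Q.
Proof.
move=> EQ; case/ker_phihatP => [->|[t Et ->]]; first by rewrite addE0.
have t0 := kerpoint_neq0 Et.
case: Q EQ => [|x y] EQ; first by rewrite /= eqxx.
have [x0|x0] := eqVneq x 0.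
  have Ey : y ^+ 2 = - 27 * k by move: EQ; rewrite x0 => /ker_x0.
  by rewrite x0 addE_kerD //; case: ifP => _; rewrite /= ?eqxx.
have Ex := curveP Et EQ; have [ty0 ->] := addE_ker Et EQ x0.
rewrite /phihat (negPf x0) ifF; last first.
  by rewrite !mulf_eq0 invr_eq0 oppr_eq0 (negPf n2) (negPf t0) (negPf x0) (negPf ty0).
have n8 : (8 : K) != 0 by rewrite (_ : 8 = 2 ^+ 3) ?expf_neq0 // -natrX.
rewrite (ker_sqE Et).
by congr Affine; field: Ex; rewrite ?oppr_eq0 ?x0 ?n9 ?n27 ?ty0 ?t0 ?n8 ?four_neq0.
Qed.

Lemma ker_E m : ker_phihat k m -> E (- 27 * k) m.
Proof. by case. Qed.

(** This is associativity of the matrix product: after lifting Q to a row vector, [psi_add] turns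
    both additions into multiplications by [stab_mx]. *)
Lemma addA_ker Q m n : E (- 27 * k) Q -> ker_phihat k m -> ker_phihat k n ->
  addE (addE Q m) n = addE Q (addE m n).
Proof.
move=> EQ km kn; rewrite -[Q]psi_lift.
have Ez := lift_curve EQ; have nx := lift_row_neq0 Q.
have um : stab_mx m \in unitmx by rewrite unitmxE stab_mx_det // unitr1.
have nx' : lift_row Q *m stab_mx m != 0.
  by apply: contra_neq nx => x0; rewrite -[lift_row Q](mulmxK um) x0 mul0mx.
have Ez' : lift_z Q ^+ 3 = cubic_ev (base_cubic k) (lift_row Q *m stab_mx m).
  by rewrite -cubic_ev_act stab_mx_act.
rewrite -(psi_add nx Ez km) -(psi_add nx' Ez' kn) -(psi_add nx Ez (ker_addE km kn)).
by rewrite stab_mxD // mulmxA.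
Qed.

Lemma oppEK P : oppE (oppE P) = P.
Proof. by case: P => //= x y; rewrite opprK. Qed.

Lemma addNE_ker m : ker_phihat k m -> addE (oppE m) m = Infinity.
Proof.
move=> km; have k_inf : ker_phihat k Infinity by apply/ker_phihatP; left.
have := addKE (ker_E (ker_oppE km)) k_inf.
by rewrite addE0 oppEK.
Qed.

(** The coboundary relation without subtraction: with a = c(s), b = s(m) and d = c'(s) it reads c(s)
    + s(m) = m + c'(s), which [stab_mx] translates into an identity of matrices. *)
Lemma ker_cobound a b m d :
  ker_phihat k a -> ker_phihat k b -> ker_phihat k m -> ker_phihat k d ->
  d = addE a (addE b (oppE m)) <-> addE a b = addE m d.
Proof.
move=> ka kb km kd; have kN := ker_oppE km.
rewrite -addA_ker //; last exact: ker_E.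
split=> [->|->].
  rewrite [RHS]ker_addC //; last by apply: ker_addE => //; exact: ker_addE.
  rewrite addA_ker //; last by apply/ker_E/ker_addE.
  by rewrite addNE_ker // addE0.
by rewrite addKE //; exact: ker_E.
Qed.

End Kernel.

(** The condition on l says that the line of slope l through (x1, y1) meets the curve again above
    x2, after division by x2 - x1; in this form it also covers tangents. *)
Lemma chord_E (K : fieldType) (k l x1 y1 x2 : K) :
  y1 ^+ 2 = x1 ^+ 3 + k ->
  l ^+ 2 * (x2 - x1) + 2 * l * y1 = x2 ^+ 2 + x1 * x2 + x1 ^+ 2 ->
  E k (chord l x1 y1 x2).
Proof.
move=> Ey El; have Ek : k = y1 ^+ 2 - x1 ^+ 3 by rewrite Ey addrC addKr.
apply/eqP; rewrite -subr_eq0.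
rewrite (_ : _ - _ = (l ^+ 2 - x1 - x2 - x1) *
  (l ^+ 2 * (x2 - x1) + 2 * l * y1 - (x2 ^+ 2 + x1 * x2 + x1 ^+ 2))).
  by rewrite El subrr mulr0.
rewrite Ek; ring.
Qed.

Lemma addE_E (K : fieldType) (k : K) P Q : (2 : K) != 0 ->
  E k P -> E k Q -> E k (addE P Q).
Proof.
move=> n2; case: P Q => [|x1 y1] [|x2 y2] //= E1 E2.
have [x12|x12] := eqVneq x1 x2.
  have [//|y12] := eqVneq y1 (- y2).
  have y1E : y1 = y2.
    have : y1 ^+ 2 == y2 ^+ 2 by rewrite E1 E2 x12.
    by rewrite eqf_sqr (negPf y12) orbF => /eqP.
  have y0 : y1 != 0 by apply: contra_neq y12 => y0; rewrite -y1E y0 oppr0.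
  by apply: chord_E => //; rewrite -x12 subrr mulr0 add0r; field; rewrite y0 n2.
have d0 : x2 - x1 != 0 by rewrite subr_eq0 eq_sym.
apply: chord_E => //.
have El : (y2 - y1) / (x2 - x1) * (x2 - x1) = y2 - y1 by rewrite divfK.
set l := _ / _ in El *.
apply: (mulIf d0).
transitivity ((l * (x2 - x1)) ^+ 2 + 2 * (l * (x2 - x1)) * y1); first by ring.
rewrite El; transitivity (y2 ^+ 2 - y1 ^+ 2); first by ring.
by rewrite E1 E2; ring.
Qed.

(** * Compatibility with field embeddings *)

Section MapPoint.
Variables (K M : fieldType) (h : {rmorphism K -> M}).

Lemma map_addE P Q : map_point h (addE P Q) = addE (map_point h P) (map_point h Q).
Proof.
case: P Q => [|x y] [|x' y'] //=; rewrite (inj_eq (fmorph_inj h)) -rmorphN.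
rewrite (inj_eq (fmorph_inj h)); case: ifP => _; last first.
  by rewrite /chord /= !(rmorphB, rmorphM, rmorphXn, fmorphV).
case: ifP => // _.
by rewrite /chord /= !(rmorphB, rmorphM, rmorphXn, fmorphV, rmorph_nat).
Qed.

Lemma map_phihat k P : map_point h (phihat k P) = phihat (h k) (map_point h P).
Proof.
case: P => //= x y; rewrite fmorph_eq0; case: ifP => //= _.
by rewrite !(rmorph_nat, fmorph_div, fmorphV, rmorphN, rmorphM, rmorphXn, rmorphD).
Qed.

Lemma map_E k P : E k P -> E (h k) (map_point h P).
Proof. by case: P => //= x y Exy; rewrite -!rmorphXn Exy rmorphD. Qed.

Lemma map_E27 k P : E (- 27 * k) P -> E (- 27 * h k) (map_point h P).
Proof. by move/map_E; rewrite rmorphM rmorphN rmorph_nat. Qed.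

Lemma map_ker k m : ker_phihat k m -> ker_phihat (h k) (map_point h m).
Proof. by case=> /map_E27 Em Pm; split=> //; rewrite -map_phihat Pm. Qed.

Lemma ker_reflect k m : ker_phihat (h k) (map_point h m) -> ker_phihat k m.
Proof.
case: m => [_|x y]; first by apply/ker_phihatP; left.
case/ker_phihatP => [//|[t Et] [/eqP]]; rewrite fmorph_eq0 => /eqP-> Ey; apply/ker_phihatP; right.
exists y => //; apply: (fmorph_inj h).
by rewrite rmorphXn Ey Et rmorphM rmorphN rmorph_nat.
Qed.

Lemma map_point_inj P Q : map_point h P = map_point h Q -> P = Q.
Proof.
case: P Q => [|x y] [|x' y'] //= [/fmorph_inj-> /fmorph_inj->] //.
Qed.

Lemma map_stab_mx k m : map_mx h (stab_mx k m) = stab_mx (h k) (map_point h m).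
Proof.
case: m => [|x t] /=; first by rewrite map_mx1.
by rewrite map_mx2 !(rmorphN, fmorph_div, rmorphM, fmorphV, rmorph_nat).
Qed.

Lemma map_lift_row P : map_mx h (lift_row P) = lift_row (map_point h P).
Proof.
by apply: row2P; case: P => [|x y];
  rewrite !mxE ?rmorph0 ?rmorph1 //= fmorph_div rmorph_nat.
Qed.

Lemma map_lift_z P : h (lift_z P) = lift_z (map_point h P).
Proof. by case: P => [|x y] /=; rewrite ?rmorph0 // fmorph_div rmorph_nat. Qed.

Lemma map_psi x z :
  map_point h (psi x z) = psi (map_mx h x) (h z).
Proof.
rewrite /psi !mxE fmorph_eq0; case: ifP => //= _.
by rewrite !(rmorph_nat, fmorphV, rmorphM).
Qed.

End MapPoint.

(** * Hilbert 90 for SL2 *)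

(* The operator prod_(i != j) (chi_i - chi_i(r_i)), realized by substituting
   multiples of x for x, kills every term but the j-th. *)
Lemma dedekind_independence (L : fieldType) (I : finType) (P : pred I)
    (X : L -> Prop) (chi : I -> L -> L) (a : I -> L) :
  X 1 -> (forall x y, X x -> X y -> X (x * y)) ->
  (forall i, chi i 1 = 1) -> (forall i x y, chi i (x * y) = chi i x * chi i y) ->
  (forall i j, P i -> P j -> i != j -> exists2 x, X x & chi i x != chi j x) ->
  (forall x, X x -> \sum_(i | P i) a i * chi i x = 0) ->
  forall j, P j -> a j = 0.
Proof.
move=> X1 XM chi1 chiM sep sum0 j Pj.
have /choice[r rP] : forall i, exists x, P i -> i != j -> X x /\ chi j x != chi i x.
  move=> i; have [/andP[Pi ij]|nij] := boolP (P i && (i != j)).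
    by have [x Xx cx] := sep _ _ Pi Pj ij; exists x => _ _; rewrite eq_sym.
  by exists 1 => Pi ij; move: nij; rewrite Pi ij.
have key (l : seq I) : {in l, forall i, P i && (i != j)} -> forall x, X x ->
    \sum_(i | P i) a i * (\prod_(i' <- l) (chi i (r i') - chi i' (r i'))) * chi i x = 0.
  elim: l => [|i0 l IHl] lP x Xx.
    by under eq_bigr do rewrite big_nil mulr1; exact: sum0.
  have /andP[Pi0 i0j] := lP _ (mem_head _ _).
  have {}IHl := IHl (fun i il => lP i (@mem_behead _ (i0 :: l) i il)).
  have [Xr _] := rP _ Pi0 i0j.
  have := IHl _ (XM _ _ Xr Xx); have := congr1 ( *%R (chi i0 (r i0))) (IHl _ Xx).
  rewrite mulr0 mulr_sumr => S1 S2; have := congr2 (fun u v => u - v) S2 S1.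
  rewrite subr0 -sumrB => H; rewrite -[RHS]H.
  by apply: eq_bigr => i _; rewrite big_cons chiM; ring.
have lP : {in enum [pred i | P i && (i != j)], forall i, P i && (i != j)}.
  by move=> i; rewrite mem_enum.
have := key _ lP 1 X1.
rewrite (bigD1 j) //= [X in _ + X]big1 => [|i /andP[Pi ij]]; last first.
  rewrite (bigD1_seq i) ?enum_uniq ?mem_enum ?inE ?Pi //=.
  by rewrite subrr mul0r mulr0 mul0r.
rewrite addr0 chi1 mulr1 => /eqP.
rewrite mulf_eq0 => /orP[/eqP//|]; rewrite prodf_seq_eq0 => /hasP[i].
rewrite mem_enum inE => /andP[Pi ij] /=; rewrite subr_eq0.
by have [_ /negPf->] := rP _ Pi ij.
Qed.

(** Each element is replaced by all roots of a separable polynomial over K that vanishes at it. *)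
Lemma gal_stable_list (K : fieldType) (L : sep_closure K) (S : seq L) :
  exists rs : seq L, {subset S <= rs} /\
    forall (s : gal L) x, x \in rs -> s x \in rs.
Proof.
elim: S => [|x S [rs [sub stab]]]; first by exists [::].
have [p sep_p rp] := sep_separable x.
have [|ps _ Dps] := @poly_roots_list _ (map_poly (sep_emb L) p).
  by rewrite map_poly_eq0 separable_poly_neq0.
exists (ps ++ rs); split=> [y|s y]; rewrite ?in_cons !mem_cat.
  by case/predU1P => [->|/sub->]; rewrite -?Dps ?rp ?orbT.
case/orP => [yp|/stab-> //]; last by rewrite orbT.
have sp : map_poly s (map_poly (sep_emb L) p) = map_poly (sep_emb L) p.
  by rewrite -map_poly_comp; apply: eq_map_poly => a /=; rewrite gal_fix.
by rewrite -Dps -{1}sp fmorph_root Dps yp.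
Qed.

Lemma gal_fixed_mx (K : fieldType) (L : sep_closure K) m n (A : 'M[L]_(m, n)) :
  (forall s : gal L, map_mx s A = A) -> exists B, A = map_mx (sep_emb L) B.
Proof.
move=> fixA; have : forall ij : 'I_m * 'I_n, exists a, A ij.1 ij.2 = sep_emb L a.
  by move=> ij; apply: gal_fixed => s; rewrite -[in RHS](fixA s) mxE.
move=> /choice[f fP]; exists (\matrix_(i, j) f (i, j)).
by apply/matrixP => i j; rewrite !mxE -fP.
Qed.

Section Hilbert90.
Variables (K : fieldType) (L : sep_closure K) (k : K).
Hypotheses (n2 : (2 : K) != 0) (n3 : (3 : K) != 0) (k0 : k != 0).
Implicit Types (s t : gal L) (c : cochain L).

Local Notation kL := (sep_emb L k).

Let n2L : (2 : L) != 0 := fmorph_natr_neq0 (sep_emb L) n2.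
Let n3L : (3 : L) != 0 := fmorph_natr_neq0 (sep_emb L) n3.
Let kL0 : kL != 0. Proof. by rewrite fmorph_eq0. Qed.

Lemma gal_ker s m : kerbar k m -> kerbar k (map_point s m).
Proof. by move/(map_ker s); rewrite gal_fix. Qed.

Lemma gal_stab_mx s m : map_mx s (stab_mx kL m) = stab_mx kL (map_point s m).
Proof. by rewrite map_stab_mx gal_fix. Qed.

Lemma stab_mx_unit m : kerbar k m -> stab_mx kL m \in unitmx.
Proof. by move=> km; rewrite unitmxE (stab_mx_det n2L n3L kL0 km) unitr1. Qed.

Lemma cochain_ext c s t : continuous_cochain c -> s =1 t -> c s = c t.
Proof. by move=> cc st; have [S SP] := cc t; apply: SP => x _. Qed.

(** Continuity at the identity gives one S for all s: if s and t agree on S, then c vanishes at s^-1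
    t, and c(t) = c(s (s^-1 t)) = c(s). *)
Lemma cocycle_locally_constant c : cocycle k c ->
  exists S : seq L, forall s t, {in S, s =1 t} -> c s = c t.
Proof.
case=> kc [cc cM]; have [e eP] := gal_one_ex L.
have mape P : map_point e P = P by case: P => //= x y; rewrite !eP.
have ce : c e = Infinity.
  have : c (gal_mul e e) = c e by apply: cochain_ext => // x /=; rewrite !eP.
  rewrite cM mape => H.
  have := addKE n2L n3L kL0 (ker_E (kc e)) (kc e).
  by rewrite H => <-; case: (c e) => //= x y; rewrite eqxx opprK eqxx.
have [S SP] := cc e; exists S => s t st.
have [r [sK rK]] := gal_inv_ex s.
have cr : c (gal_mul r t) = Infinity.
  by rewrite -ce; apply: SP => x xS /=; rewrite -st // sK eP.
rewrite -[LHS]addE0 -[Infinity]/(map_point s Infinity) -cr -cM.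
by apply: cochain_ext => // x /=; rewrite rK.
Qed.

Lemma hilbert90 c : cocycle k c ->
  exists2 g : 'M[L]_2, \det g = 1 &
    forall s, map_mx s g = g *m stab_mx kL (c s).
Proof.
move=> cc; have [kc [ccont cM]] := cc.
have [S SP] := cocycle_locally_constant cc.
have [rs [subS stab]] := gal_stable_list S.
have [e eP] := gal_one_ex L.
pose A s := stab_mx kL (c s); pose B s := invmx (A s).
have uA s : A s \in unitmx by apply: stab_mx_unit.
have AM s t : A (gal_mul s t) = A s *m map_mx s (A t).
  by rewrite /A cM (stab_mxD n2L n3L kL0 (kc s) (gal_ker s (kc t))) gal_stab_mx.
have sB s t : map_mx s (B t) = B (gal_mul s t) *m A s.
  have usA : map_mx s (A t) \in unitmx by rewrite map_unitmx.
  rewrite map_invmx -[LHS]mul1mx -(mulVmx (uA (gal_mul s t))) {2}AM.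
  by rewrite !mulmxA mulmxK.
(* The finite quotient through which c factors is represented by the self-maps of [rs] that come
   from [gal L]. *)
pose T := seq_sub rs.
pose act s : {ffun T -> T} := [ffun i => SeqSub (stab s _ (valP i))].
have actP s t : act s = act t <-> {in rs, s =1 t}.
  split=> [/ffunP H x xrs|H].
    by have := H (SeqSub xrs); rewrite !ffunE => /(congr1 val).
  by apply/ffunP => i; rewrite !ffunE; apply: val_inj; rewrite /= H ?(valP i).
pose Im (p : {ffun T -> T}) := `[< exists s, act s = p >].
have Im_act s : Im (act s) by apply/asboolP; exists s.
have /choice[rep repP] : forall p : {ffun T -> T}, exists s, Im p -> act s = p.
  move=> p; have [/asboolP[s sp]|np] := boolP (Im p); first by exists s.
  by exists e => ip; case/negP: np.
(* X is the fixed field of the automorphisms trivial on [rs]; on it s acts through [act s]. *)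
pose X x := forall t, {in rs, forall r, t r = r} -> t x = x.
have X_eq x s t : X x -> act s = act t -> s x = t x.
  move=> Xx /actP st; have [r [sK rK]] := gal_inv_ex s.
  have := Xx (gal_mul r t); rewrite /= => /(_ _)/(congr1 s); rewrite rK => -> //.
  by move=> y yrs; rewrite -st // sK.
have B_eq s t : act s = act t -> B s = B t.
  by move=> /actP st; rewrite /B /A (SP s t) // => x /subS; apply: st.
(* Poincare series: up to the adjustment of the determinant, two independent
   values of W are the rows of g. *)
pose W j x : 'rV[L]_2 := \sum_(p | Im p) rep p x *: row j (B (rep p)).
have WA s j x : X x -> map_mx s (W j x) = W j x *m A s.
  move=> Xx; pose h (p : {ffun T -> T}) : {ffun T -> T} := [ffun i => act s (p i)].
  have h_act t : h (act t) = act (gal_mul s t).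
    by apply/ffunP => i; rewrite !ffunE; apply: val_inj.
  have h_inj : injective h.
    move=> p q /ffunP pq; apply/ffunP => i; have := pq i; rewrite !ffunE => /(congr1 val) /=.
    by move/fmorph_inj/val_inj.
  have Im_h p : Im (h p) = Im p.
    apply/asboolP/asboolP => -[t tp]; last by exists (gal_mul s t); rewrite -tp h_act.
    have [r [sK rK]] := gal_inv_ex s; exists (gal_mul r t); apply: h_inj.
    by rewrite h_act -tp; apply/actP => y _ /=; rewrite rK.
  rewrite [in RHS]/W (reindex_inj h_inj) (eq_bigl _ _ Im_h) mulmx_suml /W.
  rewrite raddf_sum /=; apply: eq_bigr => p Ip.
  have act_p : act (rep (h p)) = act (gal_mul s (rep p)).
    by rewrite repP ?Im_h // -h_act repP.
  rewrite map_mxZ map_row sB (X_eq _ _ _ Xx act_p) (B_eq _ _ act_p).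
  by rewrite -scalemxAl -row_mul.
(* If every W j x were orthogonal to u, independence of the automorphisms on X would give B e u = 0,
   hence u = 0. *)
have indep (u : 'cV[L]_2) : u != 0 -> exists j x, X x /\ (W j x *m u) 0 0 != 0.
  move=> u0; apply: contrapT => nW; case/eqP: u0.
  have rowBu j : row j (B e) *m u = 0.
    have eImp := Im_act e.
    rewrite -(B_eq (rep (act e)) e (repP _ eImp)); apply/rowP => i; rewrite [RHS]mxE ord1.
    apply: (@dedekind_independence L _ Im X (fun p => rep p)
      (fun p => (row j (B (rep p)) *m u) 0 0)) => //.
    - by move=> t _; rewrite rmorph1.
    - by move=> x y Xx Xy t tfix; rewrite rmorphM Xx ?Xy.
    - by move=> p; rewrite rmorph1.
    - by move=> p x y; rewrite rmorphM.
    - move=> p q Ip Iq pq; apply: contrapT => same; case/eqP: pq.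
      rewrite -(repP p Ip) -(repP q Iq); apply/actP => r rrs; apply: contrapT => ne.
      by apply: same; exists r => [t|]; [exact|exact/eqP].
    move=> x Xx; apply: contrapT => ne; apply: nW; exists j, x; split => //.
    apply/eqP; rewrite /W mulmx_suml summxE => H; apply: ne.
    by rewrite -[RHS]H; apply: eq_bigr => p _; rewrite -scalemxAl [in RHS]mxE mulrC.
  have Bu : B e *m u = 0 by apply/row_matrixP => j; rewrite row_mul rowBu row0.
  by rewrite -[u](mulKVmx (uA e)) -/(B e) Bu mulmx0.
have [|j1 [x1 [X1 W1]]] := indep (\col_i (i == 0)%:R).
  by apply/eqP => /colP/(_ 0)/eqP; rewrite !mxE oner_eq0.
set w1 := W j1 x1 in W1.
have w1_neq0 : w1 != 0 by apply: contraNneq W1 => ->; rewrite mul0mx mxE.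
(* This vector is orthogonal to w1, and its pairing with w2 is, up to sign, the determinant of the
   rows w1 and w2. *)
have [|j2 [x2 [X2 W2]]] := indep (\col_i (if i == 0 then w1 0 1 else - w1 0 0)).
  apply: contra_neq w1_neq0 => /colP H; apply: row2P; rewrite [RHS]mxE.
    by have /eqP := H 1; rewrite !mxE oppr_eq0 => /eqP.
  by have := H 0; rewrite !mxE.
set w2 := W j2 x2 in W2.
pose g0 : 'M[L]_2 := \matrix_(i, j) (if i == 0 then w1 else w2) 0 j.
have g0E s : map_mx s g0 = g0 *m A s.
  apply/row_matrixP => i; rewrite row_mul -map_row.
  have -> : row i g0 = if i == 0 then w1 else w2 by apply/rowP => j; rewrite !mxE.
  by case: ifP => _; rewrite WA.
have det_g0 : \det g0 != 0.
  apply: contraNneq W2; rewrite (mx2_eta g0) det_mx2 !mxE /= => /eqP.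
  rewrite subr_eq0 => /eqP H; rewrite !big_ord_recl big_ord0 !mxE /=.
  have -> : lift ord0 ord0 = 1 :> 'I_2 by apply: val_inj.
  by rewrite addr0 mulrN subr_eq0 mulrC -H mulrC.
have det_fix s : s (\det g0) = \det g0.
  by rewrite -det_map_mx g0E det_mulmx (stab_mx_det n2L n3L kL0 (kc s)) mulr1.
(* Left multiplication by a Galois-invariant matrix preserves the relation s(g) = g A(s). *)
exists (mx2 (\det g0)^-1 0 0 1 *m g0).
  by rewrite det_mulmx det_mx2 mulr1 mulr0 subr0 mulVf.
move=> s; rewrite map_mxM g0E mulmxA; congr (_ *m _ *m _).
by rewrite map_mx2 fmorphV det_fix rmorph0 rmorph1.
Qed.

End Hilbert90.

(** * Forms, cocycles and cubes *)

Section FormClass.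
Variables (K : fieldType) (L : sep_closure K) (k : K).
Hypotheses (n2 : (2 : K) != 0) (n3 : (3 : K) != 0) (k0 : k != 0).
Implicit Types (s t : gal L) (c : cochain L) (f : cubic K) (g : 'M[L]_2).

Local Notation kL := (sep_emb L k).
Let n2L : (2 : L) != 0 := fmorph_natr_neq0 (sep_emb L) n2.
Let n3L : (3 : L) != 0 := fmorph_natr_neq0 (sep_emb L) n3.
Let kL0 : kL != 0. Proof. by rewrite fmorph_eq0. Qed.

(* [twisted_by g c] says that c is the cocycle s |-> g^-1 s(g). *)
Definition twisted_by g c := forall s, map_mx s g = g *m stab_mx kL (c s).

(** Collects the cocycles of all choices of g: as elements of H^1 are sets of cocycles, this is the
    class of f, with no choice made. *)
Definition form_class f : set (cochain L) :=
  [set c | cocycle k c /\ exists g, [/\ \det g = 1,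
     cubic_map (sep_emb L) f = cubic_act g (base_cubic kL) & twisted_by g c]].

(** As [stab_mx] is injective on the kernel, c(s) is determined by s(g), hence by s on the four
    entries of g; the cocycle relation comes from computing (s t)(g) in two ways. *)
Lemma twisted_cocycle g c : \det g = 1 -> (forall s, kerbar k (c s)) ->
  twisted_by g c -> cocycle k c.
Proof.
move=> /SL2_unit ug kc gc; split=> //; split.
  move=> s; exists [:: g 0 0; g 0 1; g 1 0; g 1 1] => t st.
  apply: (stab_mx_inj n2L n3L (kc t) (kc s)); apply: (can_inj (mulKmx ug)).
  rewrite -!gc [g]mx2_eta !map_mx2.
  by congr mx2; apply: st; rewrite !inE eqxx ?orbT.
move=> s t; have ksct := gal_ker s (kc t).
apply: (stab_mx_inj n2L n3L (kc _) (ker_addE (kc s) ksct)).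
apply: (can_inj (mulKmx ug)); rewrite -gc (stab_mxD n2L n3L kL0 (kc s) ksct).
rewrite mulmxA -gc -gal_stab_mx -map_mxM -gc.
by apply/matrixP => i j; rewrite !mxE.
Qed.

Lemma cubic_map_gal s f :
  cubic_map s (cubic_map (sep_emb L) f) = cubic_map (sep_emb L) f.
Proof. by case: f => a b c d; rewrite /cubic_map /= !gal_fix. Qed.

Lemma base_cubic_gal s : cubic_map s (base_cubic kL) = base_cubic kL.
Proof. by rewrite cubic_map_base_cubic gal_fix. Qed.

Lemma form_class_ex f : cubic_disc f = 4 * k -> exists c, form_class f c.
Proof.
move=> df; have dfL : cubic_disc (cubic_map (sep_emb L) f) = 4 * kL.
  by rewrite cubic_map_disc df rmorphM rmorph_nat.
have disc0 : cubic_disc (cubic_map (sep_emb L) f) != 0.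
  by rewrite dfL mulf_neq0 // four_neq0.
have [pq pq0 fpq] := cubic_root_ex n3L disc0.
have [|g dg fg] := rooted_cubic_orbit n2L kL0 dfL _ fpq.
  by move: pq0; rewrite -surjective_pairing.
have ug := SL2_unit dg.
have /choice[c cP] : forall s, exists m, kerbar k m /\ map_mx s g = g *m stab_mx kL m.
  move=> s; have [||m km gm] := @stab_base_cubicP _ _ n2L n3L kL0 (invmx g *m map_mx s g).
  - by rewrite det_mulmx det_inv det_map_mx dg invr1 rmorph1 mulr1.
  - rewrite cubic_actM -[X in cubic_act (map_mx s g) X](base_cubic_gal s) -cubic_map_act -fg.
    by rewrite cubic_map_gal fg -cubic_actM mulVmx // cubic_act1.
  by exists m; split => //; rewrite -gm mulKVmx.
exists c; split; last by exists g; split=> // s; case: (cP s).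
by apply: (twisted_cocycle dg) => s; case: (cP s).
Qed.

Lemma form_class_surj c : cocycle k c ->
  exists f, cubic_disc f = 4 * k /\ form_class f c.
Proof.
move=> cc; have [g dg gc] := hilbert90 n2 n3 k0 cc; have [kc _] := cc.
have fixed s : cubic_map s (cubic_act g (base_cubic kL)) = cubic_act g (base_cubic kL).
  by rewrite cubic_map_act base_cubic_gal gc cubic_actM (stab_mx_act n2L n3L kL0 (kc s)).
case Df : (cubic_act g (base_cubic kL)) fixed => [a b c' d] fixed.
have fixP (i : cubic L -> L) : (forall s h, s (i h) = i (cubic_map s h)) ->
    exists x, i (Cubic a b c' d) = sep_emb L x.
  by move=> iP; apply: gal_fixed => s; rewrite iP fixed.
have [a' Da] := fixP (@ca L) (fun=> fun=> erefl).
have [b' Db] := fixP (@cb L) (fun=> fun=> erefl).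
have [c1 Dc] := fixP (@Defs.cc L) (fun=> fun=> erefl).
have [d' Dd] := fixP (@cd L) (fun=> fun=> erefl).
have fE : cubic_map (sep_emb L) (Cubic a' b' c1 d') = cubic_act g (base_cubic kL).
  by rewrite Df /cubic_map -Da -Db -Dc -Dd.
exists (Cubic a' b' c1 d'); split; last by split=> //; exists g.
apply: (fmorph_inj (sep_emb L)); rewrite -cubic_map_disc fE cubic_disc_SL2 //.
by rewrite base_cubic_disc rmorphM rmorph_nat.
Qed.

(** Two choices of g for one form differ on the right by some [stab_mx m], which changes c by the
    coboundary of m. *)
Lemma form_class_H1 f c : form_class f c -> form_class f = H1_class k c.
Proof.
case=> cc [g [dg fg gc]]; have [kc _] := cc; have ug := SL2_unit dg.
apply/seteqP; split=> c' [cc' H]; have [kc' _] := cc'.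
  case: H => g' [dg' fg' gc']; split=> //.
  have [||m km gm] := @stab_base_cubicP _ _ n2L n3L kL0 (invmx g *m g').
  - by rewrite det_mulmx det_inv dg dg' invr1 mulr1.
  - by rewrite cubic_actM -fg' fg -cubic_actM mulVmx // cubic_act1.
  have Dg' : g' = g *m stab_mx kL m by rewrite -gm mulKVmx.
  exists m => // s; apply/(ker_cobound n2L n3L kL0 (kc s) (gal_ker s km) km (kc' s)).
  have ksm := gal_ker s km.
  apply: (stab_mx_inj n2L n3L (ker_addE (kc s) ksm) (ker_addE km (kc' s))).
  rewrite (stab_mxD n2L n3L kL0 (kc s) ksm) (stab_mxD n2L n3L kL0 km (kc' s)).
  apply: (can_inj (mulKmx ug)); rewrite !mulmxA -gc -Dg' -gc' Dg'.
  by rewrite map_mxM gal_stab_mx.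
split=> //; case: H => m km Dc'.
exists (g *m stab_mx kL m); split.
- by rewrite det_mulmx dg mul1r (stab_mx_det n2L n3L kL0 km).
- by rewrite cubic_actM (stab_mx_act n2L n3L kL0 km).
move=> s; rewrite map_mxM gc gal_stab_mx -mulmxA.
have /(ker_cobound n2L n3L kL0 (kc s) (gal_ker s km) km (kc' s)) H := Dc' s.
rewrite -(stab_mxD n2L n3L kL0 (kc s) (gal_ker s km)) H.
by rewrite (stab_mxD n2L n3L kL0 km (kc' s)) mulmxA.
Qed.

Lemma form_class_act f c (h : 'M[K]_2) : \det h = 1 -> form_class f c ->
  form_class (cubic_act h f) c.
Proof.
move=> dh [cc [g [dg fg gc]]]; split=> //; exists (map_mx (sep_emb L) h *m g).
split; first by rewrite det_mulmx det_map_mx dh dg rmorph1 mulr1.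
  by rewrite cubic_map_act fg cubic_actM.
move=> s; rewrite map_mxM gc mulmxA; congr (_ *m _ *m _).
by apply/matrixP => i j; rewrite !mxE gal_fix.
Qed.

Lemma form_class_orbit f f' : cubic_orbit f f' ->
  form_class f' = form_class f.
Proof.
case=> h dh ->; apply/seteqP; split=> c; last exact: form_class_act.
move=> /(form_class_act (h := invmx h)); rewrite -cubic_actM mulVmx ?SL2_unit //.
by rewrite cubic_act1 det_inv dh invr1; apply.
Qed.

(** When g and g' have the same cocycle, g' g^-1 is Galois-invariant and hence defined over K. *)
Lemma form_class_inj f f' c : form_class f c -> form_class f' c ->
  cubic_orbit f f'.
Proof.
case=> _ [g [dg fg gc]] [_ [g' [dg' fg' gc']]].
have ug := SL2_unit dg; have ug' := SL2_unit dg'.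
have [h Dh] : exists h, g' *m invmx g = map_mx (sep_emb L) h.
  apply: gal_fixed_mx => s; rewrite map_mxM map_invmx.
  have usg : map_mx s g \in unitmx by rewrite map_unitmx.
  apply: (can_inj (mulmxK usg)); rewrite mulmxKV // gc gc' mulmxA mulmxKV //.
exists h.
  apply: (fmorph_inj (sep_emb L)); rewrite -det_map_mx -Dh.
  by rewrite det_mulmx det_inv dg dg' invr1 mulr1 rmorph1.
apply: (cubic_map_inj (h := sep_emb L)).
by rewrite cubic_map_act fg fg' -Dh -cubic_actM mulmxKV.
Qed.

Definition has_cube_value (f : cubic K) :=
  exists u w z : K, (u, w, z) <> (0, 0, 0) /\ z ^+ 3 = cubic_eval f u w.

Lemma gal_fixed_point (P : ec_point L) : (forall s : gal L, map_point s P = P) ->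
  exists P', P = map_point (sep_emb L) P'.
Proof.
case: P => [|x y] fixP; first by exists Infinity.
have [|x' ->] := @gal_fixed _ L x; first by move=> s; case: (fixP s).
have [|y' ->] := @gal_fixed _ L y; first by move=> s; case: (fixP s).
by exists (Affine x' y').
Qed.

(** A rational point (x, z) gives Q = psi(x g, z); as s(g) = g stab_mx(c(s)), s moves Q to Q + c(s),
    so the image of Q under the isogeny is rational. *)
Lemma im_delta_of_cube_value f c : form_class f c -> has_cube_value f ->
  im_delta L k (H1_class k c).
Proof.
case=> cc [g [dg fg gc]] [u [w [z [nz Ez]]]]; have [kc _] := cc.
have ug := SL2_unit dg.
pose x : 'rV[K]_2 := \row_j (if j == 0 then u else w).
have Ex : z ^+ 3 = cubic_ev f x by rewrite Ez /cubic_ev !mxE.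
have x0 : x != 0.
  apply/eqP => x0; have := x0 => /rowP /[dup] /(_ 0) + /(_ 1).
  rewrite !mxE /= => u0 w0; apply: nz; rewrite u0 w0; congr (_, _, _).
  move/eqP: Ex; rewrite x0 -(scale0r 0) cubic_evZ expr0n /= mul0r.
  by rewrite expf_eq0 => /eqP.
pose xL := map_mx (sep_emb L) x; pose y := xL *m g.
have y0 : y != 0.
  apply: contra_neq x0 => y0; apply/eqP; rewrite -(map_mx_eq0 (sep_emb L)) -/xL.
  by rewrite -[xL](mulmxK ug) -/y y0 mul0mx.
have Ey : sep_emb L z ^+ 3 = cubic_ev (base_cubic kL) y.
  rewrite -cubic_ev_act -fg -rmorphXn Ex /cubic_ev.
  by rewrite -cubic_map_eval !mxE.
pose Q := psi y (sep_emb L z).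
have EQ : E (- 27 * kL) Q by apply: psi_E.
have sQ s : map_point s Q = addE Q (c s).
  rewrite map_psi gal_fix /y map_mxM gc mulmxA.
  have -> : map_mx s xL = xL by apply/matrixP => i j; rewrite !mxE gal_fix.
  exact: (psi_add n2L n3L kL0 y0 Ey (kc s)).
have [P DP] : exists P, phihat kL Q = map_point (sep_emb L) P.
  apply: gal_fixed_point => s; rewrite map_phihat gal_fix sQ.
  exact: (phihat_add n2L n3L kL0 EQ (kc s)).
exists P; split.
  have := phihat_E n3L EQ; rewrite DP; case: (P) => //= a b.
  by rewrite -!rmorphXn -rmorphD => /fmorph_inj.
exists Q; split=> //; split=> //; congr H1_class; apply/funext => s.
by rewrite sQ (addKE n2L n3L kL0 EQ (kc s)).
Qed.

(** Replacing Q by Q + m absorbs the coboundary, so that s Q' = Q' + c(s) exactly; undoing g then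
    turns Q' into a rational projective point of z^3 = f. *)
Lemma cube_value_of_im_delta f c : form_class f c ->
  im_delta L k (H1_class k c) -> has_cube_value f.
Proof.
case=> cc [g [dg fg gc]] [P [EP [Q [EQ [PQ HH]]]]]; have [kc _] := cc.
have ug := SL2_unit dg.
have kinf : kerbar k (Infinity : ec_point L) by apply/ker_phihatP; left.
have : H1_class k c c.
  by split=> //; exists Infinity => // s; rewrite /= addE0.
rewrite HH => -[_ [m km Dc]].
have EsQ s : E (- 27 * kL) (map_point s Q) by have := map_E27 s EQ; rewrite gal_fix.
pose Q' := addE Q m.
have EQ' : E (- 27 * kL) Q' by apply: addE_E => //; exact: ker_E.
have sQ' s : map_point s Q' = addE Q' (c s).
  have ksm := gal_ker s km.
  (* A priori n is only a point of the curve; n + b = c(s) puts it into the kernel, after which the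
     kernel forms of the group law apply. *)
  pose n := addE (map_point s Q) (oppE Q).
  pose b := addE (map_point s m) (oppE m).
  have kb : kerbar k b by apply: ker_addE => //; apply: ker_oppE.
  have kNb := ker_oppE kb.
  have ENQ : E (- 27 * kL) (oppE Q) by case: (Q) EQ => //= ? ?; rewrite sqrrN.
  have En : E (- 27 * kL) n by apply: addE_E.
  have Dn : n = addE (oppE b) (c s).
    by apply: (subE_ker n2L n3L kL0 En (ker_E kNb) (kc s)); rewrite oppEK -Dc.
  have kn : kerbar k n by rewrite Dn; exact: (ker_addE kNb (kc s)).
  have DsQ : map_point s Q = addE Q n.
    exact: (subE_ker n2L n3L kL0 (EsQ s) EQ kn erefl).
  have /(ker_cobound n2L n3L kL0 kn ksm km (kc s)) Dnm := Dc s.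
  rewrite map_addE DsQ (addA_ker n2L n3L kL0 EQ kn ksm) Dnm.
  by rewrite /Q' (addA_ker n2L n3L kL0 EQ km (kc s)).
pose x0 := lift_row Q'; pose z0 := lift_z Q'.
have Ex0 := lift_curve n3L EQ'.
have [X Xg] : exists X, X *m g = x0 by exists (x0 *m invmx g); rewrite mulmxKV.
have X0 : X != 0.
  by apply: contra_neq (lift_row_neq0 Q') => X0; rewrite -/x0 -Xg X0 mul0mx.
(* Lifts are determined up to scaling only, so X and z0 are Galois-invariant up to a common scalar
   l. *)
have sX s : exists2 l, map_mx s X = l *: X & s z0 = l * z0.
  have u_stab := SL2_unit (stab_mx_det n2L n3L kL0 (kc s)).
  have nx1 : x0 *m stab_mx kL (c s) != 0.
    apply: contra_neq (lift_row_neq0 Q') => e.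
    by rewrite -[lift_row _](mulmxK u_stab) e mul0mx.
  have EsQ' : E (- 27 * kL) (map_point s Q') by have := map_E27 s EQ'; rewrite gal_fix.
  have [|||||l [Dx Dz]] := @psi_inj _ kL n3L
    (lift_row (map_point s Q')) (lift_z (map_point s Q')) (x0 *m stab_mx kL (c s)) z0.
  - exact: lift_curve.
  - by rewrite -cubic_ev_act (stab_mx_act n2L n3L kL0 (kc s)).
  - exact: lift_row_neq0.
  - exact: nx1.
  - rewrite (psi_lift n3L) sQ' (psi_add n2L n3L kL0 (lift_row_neq0 Q') Ex0 (kc s)).
    by rewrite (psi_lift n3L).
  exists l; last by rewrite map_lift_z Dz.
  have usg : map_mx s g \in unitmx by rewrite map_unitmx.
  apply: (can_inj (mulmxK usg)); rewrite -map_mxM Xg map_lift_row Dx gc.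
  by rewrite -scalemxAl mulmxA Xg.
have [i Xi] : exists i, X 0 i != 0.
  apply: contrapT => nX; case/eqP: X0; apply/rowP => i; rewrite mxE.
  by apply: contrapT => Xi; apply: nX; exists i; apply/eqP.
(* Dividing by a nonzero coordinate of X removes the scalar l. *)
pose Y := (X 0 i)^-1 *: X; pose y := (X 0 i)^-1 * z0.
have sXi s l : map_mx s X = l *: X -> l != 0 /\ s (X 0 i) = l * X 0 i.
  move=> /matrixP/(_ 0 i); rewrite !mxE => H; split=> //.
  by apply: contra_neq Xi => l0; move/eqP: H; rewrite l0 mul0r fmorph_eq0 => /eqP.
have [Y' DY] : exists Y', Y = map_mx (sep_emb L) Y'.
  apply: gal_fixed_mx => s; have [l Dl _] := sX s; have [l0 Dli] := sXi _ _ Dl.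
  by rewrite map_mxZ Dl fmorphV Dli invfM scalerA mulrAC mulVf // mul1r.
have [y' Dy] : exists y', y = sep_emb L y'.
  apply: gal_fixed => s; have [l Dl Dz] := sX s; have [l0 Dli] := sXi _ _ Dl.
  by rewrite rmorphM fmorphV Dli Dz invfM mulrACA mulVf // mul1r.
exists (Y' 0 0), (Y' 0 1), y'; split.
  case=> Y0 Y1 _; have : Y = 0 by rewrite DY; apply: row2P; rewrite !mxE ?Y0 ?Y1 rmorph0.
  by move/rowP/(_ i)/eqP; rewrite !mxE mulVf // oner_eq0.
apply: (fmorph_inj (sep_emb L)); rewrite rmorphXn -Dy -cubic_map_eval fg.
rewrite [RHS](_ : _ = cubic_ev (cubic_act g (base_cubic kL)) Y); last by rewrite /cubic_ev DY !mxE.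
by rewrite cubic_ev_act /Y -scalemxAl Xg cubic_evZ exprMn Ex0.
Qed.

End FormClass.

(** * Stabilizers and the Selmer group *)

Section Stabilizer.
Variables (K : fieldType) (L : sep_closure K) (k : K).
Hypotheses (n2 : (2 : K) != 0) (n3 : (3 : K) != 0) (k0 : k != 0).

Local Notation kL := (sep_emb L k).
Local Notation i := (sep_emb L).
Let n2L : (2 : L) != 0 := fmorph_natr_neq0 (sep_emb L) n2.
Let n3L : (3 : L) != 0 := fmorph_natr_neq0 (sep_emb L) n3.
Let kL0 : kL != 0. Proof. by rewrite fmorph_eq0. Qed.

(** Over L, conjugation by g identifies the stabilizers of f and of the base form. The latter is
    commutative, so twisting by c does not change the Galois action, and invariant elements
    correspond. *)
Lemma cubic_stab_ker f : cubic_disc f = 4 * k ->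
  exists h : 'M[K]_2 -> ec_point K,
    set_bij (cubic_stab f) (ker_phihat k) h /\
    (forall g1 g2, cubic_stab f g1 -> cubic_stab f g2 ->
       h (g1 *m g2) = addE (h g1) (h g2)).
Proof.
move=> df; have [c [cc [g [dg fg gc]]]] := form_class_ex L n2 n3 k0 df.
have [kc _] := cc; have ug := SL2_unit dg.
pose T (x : 'M[K]_2) m := ker_phihat k m /\
  map_mx i x *m g = g *m stab_mx kL (map_point i m).
have comm m n : kerbar k m -> kerbar k n ->
    stab_mx kL m *m stab_mx kL n = stab_mx kL n *m stab_mx kL m.
  move=> km kn; rewrite -(stab_mxD n2L n3L kL0 km kn) (ker_addC km kn).
  exact: (stab_mxD n2L n3L kL0 kn km).
have T_ex x : cubic_stab f x -> exists m, T x m.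
  case=> dx fx.
  have [||n kn gn] := @stab_base_cubicP _ _ n2L n3L kL0 (invmx g *m (map_mx i x *m g)).
  - by rewrite !det_mulmx det_inv det_map_mx dg dx rmorph1 invr1 !mulr1.
  - rewrite !cubic_actM -fg -cubic_map_act fx fg -cubic_actM mulVmx //.
    exact: cubic_act1.
  have Dx : map_mx i x *m g = g *m stab_mx kL n by rewrite -gn mulKVmx.
  have [|m Dn] := @gal_fixed_point _ L n.
    move=> s; have ksn := gal_ker s kn.
    apply: (stab_mx_inj n2L n3L ksn kn).
    have uc := SL2_unit (stab_mx_det n2L n3L kL0 (kc s)).
    apply: (can_inj (mulKmx uc)); rewrite -(comm _ _ kn (kc s)).
    apply: (can_inj (mulKmx ug)); rewrite !mulmxA -gc -Dx -gal_stab_mx -map_mxM -Dx map_mxM.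
    by rewrite -mulmxA -gc; congr (_ *m _); apply/matrixP => a b; rewrite !mxE gal_fix.
  by exists m; split; [apply: (@ker_reflect _ _ i); rewrite -Dn | rewrite -Dn].
have T_inv m : ker_phihat k m -> exists2 x, cubic_stab f x & T x m.
  move=> km; have kmL : kerbar k (map_point i m) by exact: map_ker.
  have [x Dx] : exists x, g *m stab_mx kL (map_point i m) *m invmx g = map_mx i x.
    apply: gal_fixed_mx => s; have usg : map_mx s g \in unitmx by rewrite map_unitmx.
    rewrite !map_mxM map_invmx gal_stab_mx.
    have -> : map_point s (map_point i m) = map_point i m.
      by case: (m) => //= a b; rewrite !gal_fix.
    apply: (can_inj (mulmxK usg)); rewrite mulmxKV // gc -!mulmxA mulKmx //.
    by rewrite (comm _ _ (kc s) kmL).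
  exists x; last by split; rewrite // -Dx mulmxKV.
  have dm := stab_mx_det n2L n3L kL0 kmL.
  split.
    apply: (fmorph_inj i); rewrite -det_map_mx -Dx !det_mulmx det_inv dg dm.
    by rewrite invr1 !mulr1 rmorph1.
  apply: (cubic_map_inj (h := i)); rewrite cubic_map_act -Dx fg -cubic_actM mulmxKV //.
  by rewrite cubic_actM (stab_mx_act n2L n3L kL0 kmL).
have T_fun x m m' : T x m -> T x m' -> m = m'.
  case=> km Dm [km' Dm']; apply: (map_point_inj (h := i)).
  apply: (stab_mx_inj n2L n3L (map_ker i km) (map_ker i km')).
  by apply: (can_inj (mulKmx ug)); rewrite -Dm.
have /choice[h hP] : forall x, exists m, cubic_stab f x -> T x m.
  move=> x; have [sx|nsx] := pselect (cubic_stab f x).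
    by have [m Tm] := T_ex x sx; exists m.
  by exists Infinity.
exists h; split; first split.
- by move=> x /hP[].
- move=> x y /set_mem/hP[_ Dx] /set_mem/hP[_ Dy] hxy; apply: (map_mx_inj (f := i)).
  by apply: (can_inj (mulmxK ug)); rewrite Dx Dy hxy.
- move=> m /T_inv[x sx Tx]; exists x => //; exact: T_fun (hP x sx) Tx.
move=> x y sx sy; have [kx Dx] := hP x sx; have [ky Dy] := hP y sy.
have sxy : cubic_stab f (x *m y).
  case: sx sy => [dx fx] [dy fy]; split; last by rewrite cubic_actM fy.
  by rewrite /SL2 /= det_mulmx dx dy mulr1.
apply: T_fun (hP _ sxy) _; split; first exact: ker_addE.
rewrite map_mxM map_addE (stab_mxD n2L n3L kL0 (map_ker i kx) (map_ker i ky)).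
by rewrite -mulmxA Dy !mulmxA Dx.
Qed.

End Stabilizer.

(** * Restriction to completions and the Selmer condition *)

Section Localize.
Variables (R : realType) (F : fieldType) (L : sep_closure F).
Variables (loc : forall v : place R F, localization L v) (k : F).
Hypotheses (n2 : (2 : F) != 0) (n3 : (3 : F) != 0) (k0 : k != 0).

Lemma res_form_class v f c : form_class k f c ->
  form_class (cpl_emb (loc v) k) (cubic_map (cpl_emb (loc v)) f)
    (res_cochain (loc := loc) (v := v) c).
Proof.
case=> cc [g [dg fg gc]]; have [kc _] := cc.
pose j := loc_emb (loc v).
have jk : j (sep_emb L k) = sep_emb (loc_sep (loc v)) (cpl_emb (loc v) k).
  exact: loc_embP.
have n2v : (2 : loc v) != 0 := fmorph_natr_neq0 (cpl_emb (loc v)) n2.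
have n3v : (3 : loc v) != 0 := fmorph_natr_neq0 (cpl_emb (loc v)) n3.
have kv0 : cpl_emb (loc v) k != 0 by rewrite fmorph_eq0.
have dj : \det (map_mx j g) = 1 by rewrite det_map_mx dg rmorph1.
have tw : twisted_by (cpl_emb (loc v) k) (map_mx j g) (res_cochain (loc := loc) (v := v) c).
  move=> t; rewrite /res_cochain -jk -map_stab_mx -map_mxM -gc.
  by apply/matrixP => a b; rewrite !mxE gal_resP.
split.
  apply: (twisted_cocycle n2v n3v kv0 dj) => // t.
  by rewrite /kerbar -jk; exact: (map_ker j (kc _)).
exists (map_mx j g); split => //; rewrite -jk -cubic_map_base_cubic -cubic_map_act -fg.
by case: (f) => a b c' d; rewrite /cubic_map /= /j !loc_embP.
Qed.

Lemma locally_solubleP f c : form_class k f c ->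
  locally_soluble loc f <-> forall v : place R F,
    let kv := cpl_emb (loc v) k in
    im_delta (loc_sep (loc v)) kv
      (H1_class kv (res_cochain (loc := loc) (v := v) c)).
Proof.
move=> fc; have nat_v v := fmorph_natr_neq0 (cpl_emb (loc v)).
have kv0 v : cpl_emb (loc v) k != 0 by rewrite fmorph_eq0.
split=> sol v; have rc := res_form_class v fc.
  exact: (im_delta_of_cube_value (nat_v v _ n2) (nat_v v _ n3) (kv0 v) rc (sol v)).
exact: (cube_value_of_im_delta (nat_v v _ n2) (nat_v v _ n3) (kv0 v) rc (sol v)).
Qed.

Lemma selmerP X : selmer loc k X <->
  exists2 f, soluble_forms loc k f & X = form_class k f.
Proof.
split=> [[c cc [-> im]]|[f [sf df] ->]].
  have [f [df fc]] := form_class_surj n2 n3 k0 cc.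
  exists f; last by rewrite (form_class_H1 n2 n3 k0 fc).
  by split=> //; apply/(locally_solubleP fc).
have [c fc] := form_class_ex L n2 n3 k0 df; have [cc _] := fc.
exists c => //; split; first exact: form_class_H1.
exact/(locally_solubleP fc).
Qed.

End Localize.

Lemma natr_neq0_pchar (F : fieldType) p : prime p -> p \notin [pchar F] ->
  (p%:R : F) != 0.
Proof. by move=> pp; rewrite inE pp. Qed.

Theorem theorem23 (R : realType) (F : fieldType) (L : sep_closure F)
    (loc : forall v : place R F, localization L v) (k : F)
    (F_global : global_field F)
    (char_not2 : 2%N \notin [pchar F]) (char_not3 : 3%N \notin [pchar F])
    (k_neq0 : k != 0) :
  let f0 : cubic F := Cubic k 0 1 0 in
  [/\ exists beta : set (cubic F) -> set (cochain L),
        [/\ set_bij (soluble_orbits loc k) (selmer loc k) beta,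
            soluble_orbits loc k (cubic_orbit f0) &
            beta (cubic_orbit f0) = H1_one L k],
      [set f : cubic F | cubic_reducible f /\ cubic_disc f = 4 * k] = cubic_orbit f0 &
      forall f : cubic F, soluble_forms loc k f ->
        exists h : 'M[F]_2 -> ec_point F,
          set_bij (cubic_stab f) (ker_phihat k) h /\
          (forall g1 g2, cubic_stab f g1 -> cubic_stab f g2 ->
             h (g1 *m g2) = addE (h g1) (h g2))].
Proof.
move=> f1; rewrite -[f1]/(base_cubic k) {f1}.
have n2 := natr_neq0_pchar (isT : prime 2) char_not2.
have n3 := natr_neq0_pchar (isT : prime 3) char_not3.
split; last by move=> f [_]; exact: cubic_stab_ker.
  (* The union over the orbit avoids choosing a representative; [form_class] is constant on
     orbits. *)
  exists (fun O => [set c | exists2 f, O f & form_class k f c]).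
  have beta_orbit f : [set c | exists2 f', cubic_orbit f f' & form_class (L := L) k f' c] =
      form_class k f.
    apply/seteqP; split=> c; last by exists f => //; exact: cubic_orbit_refl.
    by case=> f' ff'; rewrite (form_class_orbit L k ff').
  split; first split.
  - move=> _ [f sf <-]; rewrite beta_orbit; apply/(selmerP loc n2 n3 k_neq0).
    by exists f.
  - move=> _ _ /set_mem[f [_ df] <-] /set_mem[f' _ <-].
    rewrite !beta_orbit => ff'; apply: cubic_orbit_eq.
    have [c fc] := form_class_ex L n2 n3 k_neq0 df.
    by apply: (form_class_inj fc); rewrite -ff'.
  - move=> _ /(selmerP loc n2 n3 k_neq0)[f sf ->].
    exists (cubic_orbit f); first by exists f.
    exact: beta_orbit.
  - exists (base_cubic k) => //; split; last exact: base_cubic_disc.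
    move=> v; exists 0, 1, 0; split; first by case=> /eqP; rewrite oner_eq0.
    by rewrite cubic_map_base_cubic base_cubic_eval; rewrite !(mulr0, mul0r, expr0n, addr0).
  rewrite beta_orbit; apply: (form_class_H1 n2 n3 k_neq0).
  have d1 : \det (1%:M : 'M[L]_2) = 1 by rewrite det1.
  have tw : twisted_by k (1%:M : 'M[L]_2) (fun=> Infinity).
    by move=> s; rewrite map_mx1 mulmx1.
  split; last by exists 1%:M; rewrite cubic_map_base_cubic cubic_act1.
  by apply: (twisted_cocycle n2 n3 k_neq0 d1) => // s; apply/ker_phihatP; left.
apply/seteqP; split=> [f [rf df]|_ [g dg ->]]; last first.
  by split; [exact: base_cubic_orbit_reducible | rewrite cubic_disc_SL2 // base_cubic_disc].
have [[p q] pq0 fpq] := cubic_reducible_root rf.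
have [g dg ->] := rooted_cubic_orbit n2 k_neq0 df pq0 fpq.
by exists g.
Qed.
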